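(* Let $(\rho,V,V_{\wp}^+)$ be a triple satisfying HYP 1 and HYP 2, and assume that $H^0(\Delta_\wp, V) = 0$. Let $\varphi: \Gamma \to \mathcal{O}^*$ be a continuous group homomorphism. Then the restriction map $Sel^{GV}_{\mathbb{Q}_n}(A,A_\wp^+,\varphi) \to Sel^{GV}_{\mathbb{Q}_\infty}(A,A_\wp^+,\varphi)^{\Gamma_n}$ is injective, and its cokernel is finite for all $n$, with cardinality bounded independently of $n$.
   Context: Fix an odd prime $p$. HYP 1: $\mathbb{Q}(\mu_p)\subset K$, where $K$ is a finite Galois extension of $\mathbb{Q}$ with $p \nmid |\Delta|$, $\Delta=\mathrm{Gal}(K/\mathbb{Q})$. HYP 2: $\rho:\Delta\to \mathrm{Gl}_{\mathcal{F}}(V)$ is an irreducible representation on a vector space $V$ of dimension $d(\rho)$ over a finite extension $\mathcal{F}$ of $\mathbb{Q}_p$ (ring of integers $\mathcal{O}$); for the prime $\wp$ of $K$ above $p$ determined by a fixed embedding $\overline{\mathbb{Q}}\hookrightarrow\overline{\mathbb{Q}}_p$, with decomposition group $\Delta_\wp$, $V$ has a $\Delta_\wp$-invariant subspace $V_\wp^+$ of dimension $d^+(\rho)$ with $0<d^+(\rho)<d(\rho)$ (here $d^+(\rho)$ is the multiplicity of the trivial representation in the restriction of $\rho$ to the decomposition group at an archimedean place), and $V_\wp^+$ and $V_\wp^-:=V/V_\wp^+$ have no common irreducible component as $\Delta_\wp$-representations. Choose a $\Delta$-stable $\mathcal{O}$-lattice $T\subset V$; put $A=V/T$, $A_\wp^+$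 the image of $V_\wp^+$ in $A$, $A_\wp^-=A/A_\wp^+$. Let $\mathbb{Q}_\infty$ be the cyclotomic $\mathbb{Z}_p$-extension of $\mathbb{Q}$, $\Gamma=\mathrm{Gal}(\mathbb{Q}_\infty/\mathbb{Q})$, $\Gamma_n=\Gamma^{p^n}$, $\mathbb{Q}_n=\mathbb{Q}_\infty^{\Gamma_n}$, and $\mathfrak{p}_n$ the unique prime of $\mathbb{Q}_n$ above $p$. For $\varphi:\Gamma\to\mathcal{O}^*$ continuous, $A(\varphi)=A\otimes_{\mathcal{O}}\mathcal{O}(\varphi)$ with diagonal Galois action, and similarly $A_\wp^{\pm}(\varphi)$. Let $\Sigma$ be a finite set of primes containing $p$, $\infty$ and the primes ramified in $K/\mathbb{Q}$, and $\mathbb{Q}_\Sigma$ the maximal extension of $\mathbb{Q}$ unramified outside $\Sigma$. For a prime $\omega$ of $\mathbb{Q}_n$ let $I_\omega$ be its inertia group. Define $Sel^{GV}_{\mathbb{Q}_n}(A,A_\wp^+,\varphi)=\mathrm{Ker}\big(H^1(\mathbb{Q}_\Sigma/\mathbb{Q}_n, A(\varphi)) \to \bigoplus_{\omega \mid \Sigma,\ \omega \nmid p\infty} H^1(I_\omega, A(\varphi)) \oplus H^1(I_{\mathfrak{p}_n}, A_\wp^-(\varphi))\big)$, and $Sel^{GV}_{\mathbb{Q}_\infty}(A,A_\wp^+,\varphi)=\varinjlim_n Sel^{GV}_{\mathbb{Q}_n}(A,A_\wp^+,\varphi)$ with respect to restriction maps. *)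

(* Defs.v *)
From HB Require Import structures.
From mathcomp Require Import all_boot all_order all_fingroup all_algebra.
From mathcomp Require Import all_solvable all_field all_character.
From mathcomp Require Import boolp classical_sets functions cardinality.

Set Implicit Arguments.
Unset Strict Implicit.
Unset Printing Implicit Defensive.

Import Order.TTheory GRing.Theory Num.Theory.

Local Open Scope classical_set_scope.
Local Open Scope ring_scope.
Local Open Scope quotient_scope.

(* An element of lim Z/p^n, the residue modulo p^n being represented by the
   integer of [0, p^n[: the single equation below expresses both that
   normalisation and the compatibility of the residues. *)
Record Zp (p : nat) (p_pr : prime p) := MkZp {
  residue : nat -> int;
  residueP : forall n, residue n = (residue n.+1 %% (p ^ n)%N)%Z }.

Section PadicIntegers.

Lemma modz_dvdm (d e m : int) :
  (e %| d)%Z -> ((m %% d)%Z = m %[mod e])%Z.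
Proof. by case/dvdzP=> k ->; rewrite {2}(divz_eq m (k * e)) mulrA modzMDl. Qed.

Variables (p : nat) (p_pr : prime p).
Local Notation Z_p := (Zp p_pr).
Implicit Types x y z : Z_p.

Lemma dvdz_exp2l m n : (m <= n)%N -> ((p ^ m)%N %| (p ^ n)%N%:Z)%Z.
Proof. by move=> mn; rewrite dvdzE !absz_nat dvdn_exp2l. Qed.

HB.instance Definition _ := gen_eqMixin Z_p.
HB.instance Definition _ := gen_choiceMixin Z_p.

Lemma Zp_eq x y : residue x =1 residue y -> x = y.
Proof.
case: x y => [u Pu] [v Pv] /= /funext uv; move: Pu; rewrite uv => Pu.
by congr MkZp; apply: Prop_irrelevance.
Qed.

Lemma residue_mod x n : (residue x n %% (p ^ n)%N)%Z = residue x n.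
Proof. by rewrite {1}residueP modz_mod -residueP. Qed.

Lemma residue_modS x n :
  (residue x n.+1 = residue x n %[mod (p ^ n)%N])%Z.
Proof. by rewrite residue_mod -residueP. Qed.

Lemma Zp_of_subproof (f : nat -> int)
    (fP : forall n, (f n.+1 = f n %[mod (p ^ n)%N])%Z) n :
  (f n %% (p ^ n)%N)%Z = ((f n.+1 %% (p ^ n.+1)%N)%Z %% (p ^ n)%N)%Z.
Proof.
by rewrite -fP modz_dvdm // dvdz_exp2l.
Qed.

Definition Zp_of f fP : Z_p := MkZp p_pr (@Zp_of_subproof f fP).

Lemma Zp_add_subproof x y n :
  (residue x n.+1 + residue y n.+1 = residue x n + residue y n
     %[mod (p ^ n)%N])%Z.
Proof. by rewrite -modzDm !residue_modS modzDm. Qed.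

Lemma Zp_mul_subproof x y n :
  (residue x n.+1 * residue y n.+1 = residue x n * residue y n
     %[mod (p ^ n)%N])%Z.
Proof. by rewrite -modzMm !residue_modS modzMm. Qed.

Lemma Zp_opp_subproof x n :
  (- residue x n.+1 = - residue x n %[mod (p ^ n)%N])%Z.
Proof. by rewrite -modzNm residue_modS modzNm. Qed.

Definition Zp_const (a : int) : Z_p := Zp_of (f := fun=> a) (fun=> erefl).
Definition Zp_add x y : Z_p := Zp_of (Zp_add_subproof x y).
Definition Zp_mul x y : Z_p := Zp_of (Zp_mul_subproof x y).
Definition Zp_opp x : Z_p := Zp_of (Zp_opp_subproof x).

Lemma Zp_addA : associative Zp_add.
Proof. by move=> x y z; apply: Zp_eq => n /=; rewrite modzDml modzDmr addrA. Qed.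

Lemma Zp_addC : commutative Zp_add.
Proof. by move=> x y; apply: Zp_eq => n /=; rewrite addrC. Qed.

Lemma Zp_add0 : left_id (Zp_const 0) Zp_add.
Proof. by move=> x; apply: Zp_eq => n /=; rewrite modzDml add0r residue_mod. Qed.

Lemma Zp_addN : left_inverse (Zp_const 0) Zp_opp Zp_add.
Proof. by move=> x; apply: Zp_eq => n /=; rewrite modzDml addNr. Qed.

HB.instance Definition _ :=
  GRing.isZmodule.Build Z_p Zp_addA Zp_addC Zp_add0 Zp_addN.

Lemma Zp_mulA : associative Zp_mul.
Proof. by move=> x y z; apply: Zp_eq => n /=; rewrite modzMml modzMmr mulrA. Qed.

Lemma Zp_mulC : commutative Zp_mul.
Proof. by move=> x y; apply: Zp_eq => n /=; rewrite mulrC. Qed.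

Lemma Zp_mul1 : left_id (Zp_const 1) Zp_mul.
Proof. by move=> x; apply: Zp_eq => n /=; rewrite modzMml mul1r residue_mod. Qed.

Lemma Zp_mulDl : left_distributive Zp_mul Zp_add.
Proof.
by move=> x y z; apply: Zp_eq => n /=; rewrite modzMml modzDml modzDmr mulrDl.
Qed.

Lemma Zp_one_neq0 : Zp_const 1 != Zp_const 0.
Proof.
apply/eqP => /(congr1 (fun x : Z_p => residue x 1)) /=.
by rewrite expn1 mod0z modz_small //= ltz_nat prime_gt1.
Qed.

HB.instance Definition _ := GRing.Zmodule_isComNzRing.Build Z_p
  Zp_mulA Zp_mulC Zp_mul1 Zp_mulDl Zp_one_neq0.

Definition Zp_unit : {pred Z_p} := fun x => `[< exists y, y * x = 1 >].
Definition Zp_inv x : Z_p :=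
  if pselect (exists y, y * x = 1) is left h then sval (cid h) else x.

Lemma Zp_mulV : {in Zp_unit, left_inverse 1 Zp_inv *%R}.
Proof.
move=> x /asboolP ux; rewrite /Zp_inv; case: pselect => // h.
exact: svalP (cid h).
Qed.

Lemma Zp_unitP x y : y * x = 1 -> Zp_unit x.
Proof. by move=> yx1; apply/asboolP; exists y. Qed.

Lemma Zp_inv_out : {in [predC Zp_unit], Zp_inv =1 id}.
Proof.
move=> x; rewrite inE => /asboolPn ux.
by rewrite /Zp_inv; case: pselect.
Qed.

HB.instance Definition _ :=
  GRing.ComNzRing_hasMulInverse.Build Z_p Zp_mulV Zp_unitP Zp_inv_out.

Lemma residue_le x m n :
  (m <= n)%N -> (residue x n = residue x m %[mod (p ^ m)%N])%Z.
Proof.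
move=> /subnK <-; elim: (n - m)%N => [//|k IHk].
rewrite addSn -IHk; have := residue_modS x (k + m).
move=> /(congr1 (fun a => a %% (p ^ m)%N)%Z).
by rewrite !modz_dvdm // dvdz_exp2l // leq_addl.
Qed.

Lemma residue_neq0 x : x != 0 ->
  exists n, forall m, (n <= m)%N -> ~~ ((p ^ n)%N %| residue x m)%Z.
Proof.
move=> /eqP x0; apply: contra_notP x0 => h; apply: Zp_eq => n /=.
rewrite mod0z; apply: contra_notP h => /eqP xn0; exists n => m nm.
apply: contra xn0 => /dvdz_mod0P; rewrite residue_le // residue_mod.
by move=> ->.
Qed.

Lemma Zp_mulf_eq0 : GRing.integral_domain_axiom Z_p.
Proof.
move=> x y xy0; apply/negPn; rewrite negb_or; apply/negP => /andP[].
move=> /residue_neq0[m xm] /residue_neq0[n yn].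
have {}xm := xm (m + n)%N (leq_addr n m).
have {}yn := yn (m + n)%N (leq_addl m n).
have: ((p ^ (m + n))%N %| residue x (m + n) * residue y (m + n))%Z.
  apply/dvdz_mod0P; have := congr1 (fun z : Z_p => residue z (m + n)) xy0.
  by rewrite /= mod0z.
move: xm yn; set a := residue x _; set b := residue y _.
rewrite !dvdzE !absz_nat abszM => am bn.
have a0 : (0 < `|a|)%N by case: posnP am => // ->; rewrite dvdn0.
have b0 : (0 < `|b|)%N by case: posnP bn => // ->; rewrite dvdn0.
move: am bn; rewrite !pfactor_dvdn ?muln_gt0 ?a0 ?b0 // lognM //.
by rewrite -!ltnNge => am bn; rewrite leqNgt -addSn leq_add // ltnW.
Qed.

HB.instance Definition _ :=
  GRing.ComUnitRing_isIntegral.Build Z_p Zp_mulf_eq0.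

End PadicIntegers.

Notation Qp p_pr := {fraction (Zp p_pr)}.

(* The valuation ring of an algebraic extension j : Q_p -> E, i.e. the integral
   closure of Z_p in E, and its group of units and maximal ideal. *)
Section ValuationRing.

Variables (p : nat) (p_pr : prime p) (E : fieldType) (j : Qp p_pr -> E).

Definition val_ring : set E :=
  [set x | integralOver (j \o @tofrac (Zp p_pr)) x].

Definition val_units : set E :=
  [set x | val_ring x /\ exists2 y, val_ring y & x * y = 1].

Definition val_ideal : set E := val_ring `\` val_units.

End ValuationRing.

Notation integers_of F := (@val_ring _ _ F (GRing.in_alg F)).
Notation units_of F := (@val_units _ _ F (GRing.in_alg F)).

(* algC is the algebraic closure of Q. As it is algebraic over Q, its ring
   endomorphisms are automatically bijective. *)
Record absGal := AbsGal {
  autC :> algC -> algC;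
  autCP : zmod_morphism autC /\ monoid_morphism autC }.

HB.instance Definition _ (s : absGal) :=
  GRing.isZmodMorphism.Build algC algC (autC s) (autCP s).1.
HB.instance Definition _ (s : absGal) :=
  GRing.isMonoidMorphism.Build algC algC (autC s) (autCP s).2.

HB.instance Definition _ := gen_eqMixin absGal.
HB.instance Definition _ := gen_choiceMixin absGal.

Lemma absGal_eq (s t : absGal) : s =1 t -> s = t.
Proof.
case: s t => [s sP] [t tP] /= /funext st; rewrite {}st in sP *.
by congr AbsGal; apply: Prop_irrelevance.
Qed.

Definition absGal_of (f : {rmorphism algC -> algC}) : absGal :=
  AbsGal (conj (raddfB f) (rmorphism_monoidP f)).

Definition absGal_one : absGal := absGal_of idfun.
Definition absGal_mul (s t : absGal) : absGal := absGal_of (s \o t).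
Definition absGal_inv (s : absGal) : absGal := absGal_of (algC_invaut s).

Lemma absGal_mulA : associative absGal_mul.
Proof. by move=> s t u; apply: absGal_eq. Qed.
Lemma absGal_mul1 : left_id absGal_one absGal_mul.
Proof. by move=> s; apply: absGal_eq. Qed.
Lemma absGal_mulr1 : right_id absGal_one absGal_mul.
Proof. by move=> s; apply: absGal_eq. Qed.
Lemma absGal_mulV : left_inverse absGal_one absGal_inv absGal_mul.
Proof. by move=> s; apply: absGal_eq => x /=; rewrite algC_autK. Qed.
Lemma absGal_mulrV : right_inverse absGal_one absGal_inv absGal_mul.
Proof. by move=> s; apply: absGal_eq => x /=; rewrite algC_invautK. Qed.

HB.instance Definition _ := isGroup.Build absGal
  absGal_mulA absGal_mul1 absGal_mulr1 absGal_mulV absGal_mulrV.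

Lemma absGalM (s t : absGal) x : (s * t)%g x = s (t x).
Proof. by []. Qed.

Definition subfield (L : set algC) : Prop :=
  [/\ L 1, forall x y, L x -> L y -> L (x - y)
         & forall x y, L x -> L y -> L (x / y)].

Definition gen_subfield (X : set algC) : set algC :=
  \bigcap_(L in [set L | subfield L /\ X `<=` L]) L.

Definition agree_on (L : set algC) (s t : absGal) : Prop :=
  forall x, L x -> s x = t x.

(* Gal(algC / L) *)
Definition Gal_over (L : set algC) : set absGal := [set s | agree_on L s 1%g].

Definition fixed_in (L : set algC) (H : set absGal) : set algC :=
  [set x | L x /\ forall s, H s -> s x = x].

(* For L normal over Q, Gal(L/k) is the quotient of Gal_over k by Gal_over L;
   elements and functions of Gal(L/k) are handled through representatives in
   absGal. Continuity on H, for the Krull topology of Gal(L/Q), of a function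
   with values in a discrete set: as the seq below is contained in L, it implies
   that the value at s only depends on the restriction of s to L. *)
Definition krull_continuous (L : set algC) (H : set absGal) (T : Type)
    (c : absGal -> T) : Prop :=
  forall s, H s -> exists2 r : seq algC, (forall x, x \in r -> L x) &
    forall t, H t -> {in r, s =1 t} -> c t = c s.

(* Elements of Gal(L/Q) that are k-th powers in Gal(L/Q). *)
Definition gal_powers (L : set algC) (k : nat) : set absGal :=
  [set s | exists t : absGal, agree_on L s (t ^+ k)%g].

Record int_prime (P : set algC) : Prop := IntPrime {
  int_prime_sub : forall x, P x -> x \in Aint;
  int_prime0 : P 0;
  int_primeB : forall x y, P x -> P y -> P (x - y);
  int_primeM : forall a x, a \in Aint -> P x -> P (a * x);
  int_prime1 : ~ P 1;
  int_primeP : forall x y, x \in Aint -> y \in Aint ->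
    P (x * y) -> P x \/ P y }.

Definition prime_above (l : nat) (P : set algC) : Prop :=
  int_prime P /\ P l%:R.

Definition decomposition (P : set algC) : set absGal :=
  [set s | autC s @` P = P].

Definition inertia (P : set algC) : set absGal :=
  [set s | decomposition P s /\ forall x, x \in Aint -> P (s x - x)].

Definition unramified_at (l : nat) (L : set algC) : Prop :=
  forall P, prime_above l P -> inertia P `<=` Gal_over L.

(* S lists the finite primes of the set Sigma; infinity is always in Sigma. *)
Definition Q_Sigma (S : seq nat) : set algC :=
  \bigcup_(L in [set L | subfield L /\
                   forall l, prime l -> l \notin S -> unramified_at l L]) L.

(* The prime determined by an embedding of algC in an algebraic closure
   j : Q_p -> E of Q_p. *)
Definition prime_of_embedding (p : nat) (p_pr : prime p) (E : fieldType)
    (j : Qp p_pr -> E) (iota : algC -> E) : set algC :=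
  [set x | x \in Aint /\ val_ideal j (iota x)].

Section Cyclotomic.

Variable p : nat.

Definition Q_mu_pinf : set algC :=
  gen_subfield [set z | exists n, z ^+ (p ^ n) = 1].

(* The fixed field of the torsion subgroup of Gal(Q(mu_{p^oo})/Q) = Z_p^*. *)
Definition Q_infty : set algC :=
  fixed_in Q_mu_pinf
    [set s | exists2 m, (0 < m)%N & Gal_over Q_mu_pinf (s ^+ m)%g].

Definition Gamma_ (n : nat) : set absGal := gal_powers Q_infty (p ^ n).

Definition Q_ (n : nat) : set algC := fixed_in Q_infty (Gamma_ n).

Lemma Gamma_decr n m : (n <= m)%N -> Gamma_ m `<=` Gamma_ n.
Proof.
move=> nm s [t st]; exists (t ^+ (p ^ (m - n)))%g.
by rewrite -expgM -expnD subnK.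
Qed.

Lemma Q_incr n m : (n <= m)%N -> Q_ n `<=` Q_ m.
Proof.
by move=> nm x [Lx fx]; split=> // s /(Gamma_decr nm); apply: fx.
Qed.

End Cyclotomic.

Local Notation repr := generic_quotient.repr.

Definition proj (U : zmodType) (I : zmodClosed U) (x : U) : {ideal_quot I} :=
  \pi_({ideal_quot I}) x.
Arguments proj {U} I x.

Lemma proj_eq (U : zmodType) (I : zmodClosed U) (x y : U) :
  proj I x = proj I y <-> x - y \in I.
Proof.
by rewrite Quotient.idealrBE; split=> [/eqP|/eqP].
Qed.

Lemma repr_proj (U : zmodType) (I : zmodClosed U) (x : U) :
  repr (proj I x) - x \in I.
Proof. by apply/proj_eq; rewrite /proj reprK. Qed.

Lemma projB (U : zmodType) (I : zmodClosed U) : zmod_morphism (proj I).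
Proof. by move=> x y; rewrite /proj raddfB. Qed.

Section QuotientMap.

Variables (U : zmodType) (I : zmodClosed U) (f : U -> U).

Definition quot_map (x : {ideal_quot I}) : {ideal_quot I} :=
  proj I (f (repr x)).

Hypotheses (fB : zmod_morphism f) (fI : forall x, x \in I -> f x \in I).

Lemma quot_map_proj x : quot_map (proj I x) = proj I (f x).
Proof. by apply/proj_eq; rewrite -fB fI // repr_proj. Qed.

Lemma quot_map_zmod_morphism : zmod_morphism quot_map.
Proof.
move=> x y; rewrite -[x]reprK -[y]reprK -!/(proj I _) -projB.
by rewrite !quot_map_proj fB projB.
Qed.

End QuotientMap.

Section Cohomology.

Variables (M : zmodType) (act : absGal -> M -> M).

Definition coboundary (H : set absGal) : set (absGal -> M) :=
  [set c | exists a, forall s, H s -> c s = act s a - a].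

(* Continuous cocycles of the image of H in Gal(L/Q). *)
Definition cocycle (L : set algC) (H : set absGal) : set (absGal -> M) :=
  [set c | (forall s t, H s -> H t -> c (s * t)%g = c s + act s (c t)) /\
           krull_continuous L H c].

Definition conj_cochain (g : absGal) (c : absGal -> M) : absGal -> M :=
  fun s => act g (c (g^-1 * s * g)%g).

End Cohomology.

(* X / f(Y), as a set of cosets *)
Definition cokernel (V : Type) (W : zmodType) (f : V -> W) (Y : set V)
    (X : set W) : set (set W) :=
  [set [set x + f y | y in Y] | x in X].

Notation "'Delta_of' K" := ('Gal({:K%type} / 1%VS))%G
  (at level 10, K at level 8, only parsing).

Section NumberField.

Variables (K : splittingFieldType rat) (kC : {rmorphism K -> algC}).
Local Notation Delta := (Delta_of K).

Lemma restriction_subproof (s : absGal) :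
  exists g : gal_of {:K}, forall x, kC (g x) = s (kC x).
Proof.
have [f fP] := restrict_aut_to_normal_num_field kC s.
have homf : kHom 1 {:K} (linfun f).
  apply/kHomP_tmp; split=> [x /vlineP[a ->]|x y _ _]; rewrite !lfunE /=.
    by rewrite rmorph_alg.
  by rewrite rmorphM.
have autf : kAut 1 {:K} (linfun f) by rewrite kAutfE.
have [g _ gP] := kAut_to_gal autf.
by exists g => x; rewrite -gP ?memvf // lfunE fP.
Qed.

Definition restriction (s : absGal) : gal_of {:K} :=
  sval (cid (restriction_subproof s)).

Lemma restrictionP (s : absGal) x : kC (restriction s x) = s (kC x).
Proof. exact: (svalP (cid (restriction_subproof s))). Qed.

Lemma mem_restriction s : restriction s \in Delta.
Proof.
rewrite gal_kHom ?sub1v //; apply/kAHomP => x /vlineP[a ->].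
by rewrite linearZ /= rmorph1.
Qed.

(* The product x * y of gal_of is "x, then y", contrary to that of absGal.
   Matrix representations act on row vectors on the right, so that
   v |-> v *m rho (restriction s) is an ordinary left action of absGal. *)
Lemma restrictionM s t :
  restriction (s * t)%g = (restriction t * restriction s)%g.
Proof.
apply/eqP/gal_eqP => x _; apply: (fmorph_inj kC).
by rewrite galM ?memvf // !restrictionP absGalM.
Qed.

Definition prime_in (P : set algC) : set K := kC @^-1` P.

Definition decomp_in (P : set algC) : {set gal_of {:K}} :=
  [set g in Delta | `[< forall x, prime_in P (g x) <-> prime_in P x >]]%SET.

Lemma decomp_in_group_set P : group_set (decomp_in P).
Proof.
apply/group_setP; split=> [|g h]; rewrite !inE ?group1 /=.
  by apply/asboolP => x; rewrite gal_id.
case/andP=> Dg /asboolP gP /andP[Dh /asboolP hP]; rewrite groupM //=.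
by apply/asboolP => x; rewrite galM ?memvf // hP.
Qed.
Canonical decomp_in_group P := Group (decomp_in_group_set P).

Lemma decomp_in_sub P : decomp_in P \subset Delta.
Proof. by apply/fintype.subsetP => g; rewrite inE => /andP[]. Qed.

(* The stabiliser of the archimedean absolute value x |-> `|kC x| of K *)
Definition arch_decomp : {set gal_of {:K}} :=
  [set g in Delta | `[< forall x, `|kC (g x)| = `|kC x| >]]%SET.

(* The multiplicity of the trivial representation in the restriction of rho to
   the archimedean decomposition group is the dimension of its invariants. *)
Definition d_plus (F : fieldType) d (rho : mx_representation F Delta d) : nat :=
  \rank (rfix_mx rho arch_decomp).

Definition restr_decomp (F : fieldType) d (rho : mx_representation F Delta d)
    (P : set algC) : mx_representation F (decomp_in P) d :=
  subg_repr rho (decomp_in_sub P).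

End NumberField.

Definition irr_component (F : fieldType) (gT : finGroupType) (G : {group gT})
    n (r : mx_representation F G n) m (w : mx_representation F G m) : Prop :=
  mx_irreducible w /\
  exists (U : 'M[F]_n) (modU : mxmodule r U), mx_rsim w (submod_repr modU).

Definition no_common_component (F : fieldType) (gT : finGroupType)
    (G : {group gT}) n1 (r1 : mx_representation F G n1)
    n2 (r2 : mx_representation F G n2) : Prop :=
  forall m (w : mx_representation F G m),
    ~ (irr_component r1 w /\ irr_component r2 w).

Section SelmerGroups.

Variables (p : nat) (p_pr : prime p).
Variables (K : splittingFieldType rat) (kC : {rmorphism K -> algC}).
Variables (F : fieldExtType (Qp p_pr)) (d : nat).
Variable rho : mx_representation F (Delta_of K) d.
Local Notation Delta := (Delta_of K).
Local Notation O := (integers_of F).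

(* A Delta-stable O-lattice: the O-span of a basis of F^d *)
Record stable_lattice := StableLattice {
  lattice :> zmodClosed 'rV[F]_d;
  latticeP : exists2 B : 'M[F]_d, B \in unitmx & forall v,
    v \in lattice <-> exists2 c : 'rV[F]_d, (forall i, O (c 0 i)) & v = c *m B;
  lattice_stable : forall g v, g \in Delta ->
    v \in lattice -> v *m rho g \in lattice }.

(* A continuous homomorphism Gamma = Gal(Q_infty/Q) -> O^*, for the p-adic
   topology of O^*, seen as a function on absGal: since the p^k O intersect in 0,
   the last field implies that it factors through Gamma. *)
Record gamma_char := GammaChar {
  char_fun :> absGal -> F;
  char_unit : forall s, units_of F (char_fun s);
  charM : forall s t, char_fun (s * t)%g = char_fun s * char_fun t;
  char_continuous : forall (s : absGal) (k : nat),
    exists2 r : seq algC, (forall x, x \in r -> Q_infty p x) &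
      forall t : absGal, {in r, s =1 t} ->
        exists2 y, O y & char_fun t - char_fun s = p%:R ^+ k * y }.

Variables (T : stable_lattice) (phi : gamma_char).

Lemma lattice_scale a v : O a -> v \in lattice T -> a *: v \in lattice T.
Proof.
move=> Oa; case: (latticeP T) => B _ TP /TP[c Oc ->]; apply/TP.
exists (a *: c); last by rewrite scalemxAl.
move=> i; rewrite mxE.
exact: (integral_mul (RtoK := GRing.in_alg F \o @tofrac (Zp p_pr)) Oa (Oc i)).
Qed.

(* A(phi), where A = V / T *)
Definition A_mod : zmodType := {ideal_quot (lattice T)}.

Definition V_act (s : absGal) (v : 'rV[F]_d) : 'rV[F]_d :=
  phi s *: (v *m rho (restriction kC s)).

Definition A_act (s : absGal) : A_mod -> A_mod := quot_map (V_act s).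

Lemma V_actB s : zmod_morphism (V_act s).
Proof. by move=> u v; rewrite /V_act mulmxBl scalerBr. Qed.

Lemma V_act_lattice s v : v \in lattice T -> V_act s v \in lattice T.
Proof.
move=> Tv; apply: lattice_scale; first by case: (char_unit phi s).
exact: lattice_stable (mem_restriction kC s) Tv.
Qed.

Lemma A_act_proj s v : A_act s (proj T v) = proj T (V_act s v).
Proof. exact: quot_map_proj (V_actB s) (@V_act_lattice s) v. Qed.

Lemma A_actB s : zmod_morphism (A_act s).
Proof. exact: quot_map_zmod_morphism (V_actB s) (@V_act_lattice s). Qed.

Lemma A_actM s t a : A_act (s * t)%g a = A_act s (A_act t a).
Proof.
rewrite -[a]reprK -/(proj T _) !A_act_proj /V_act restrictionM charM.
by rewrite repr_mxM ?mem_restriction // mulmxA -scalemxAl scalerA.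
Qed.

(* A^+ and A^- = A / A^+, for V^+ the row space of Vp *)
Variable Vp : 'M[F]_d.

Definition A_plus : {pred A_mod} :=
  fun a => `[< exists2 v : 'rV[F]_d, (v <= Vp)%MS & a = proj T v >].

Lemma A_plus_zmod_closed : zmod_closed A_plus.
Proof.
split=> [|_ _ /asboolP[u Vu ->] /asboolP[v Vv ->]]; apply/asboolP.
  by exists 0; rewrite ?sub0mx // /proj raddf0.
by exists (u - v); rewrite ?projB // addmx_sub ?eqmx_opp.
Qed.
HB.instance Definition _ :=
  GRing.isZmodClosed.Build A_mod A_plus A_plus_zmod_closed.

Definition A_minus : zmodType := {ideal_quot A_plus}.

(* Only meaningful on the elements of absGal that stabilise A^+, in particular
   on the decomposition group of the fixed prime above p. *)
Definition A_minus_act (s : absGal) : A_minus -> A_minus := quot_map (A_act s).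

Definition B1_at (n : nat) : {pred absGal -> A_mod} :=
  fun c => `[< coboundary A_act (Gal_over (Q_ p n)) c >].

Lemma coboundary_zmod_closed H : 
  coboundary A_act H 0 /\
  forall b c, coboundary A_act H b -> coboundary A_act H c ->
    coboundary A_act H (b - c).
Proof.
split=> [|b c [x bx] [y cy]].
  by exists 0 => s _; rewrite -[in A_act s 0](subrr 0) A_actB !subrr.
exists (x - y) => s Hs; rewrite A_actB.
have -> : (b - c) s = b s - c s by [].
by rewrite bx // cy // [- (x - y)]opprD addrACA -opprD.
Qed.

Lemma B1_at_zmod_closed n : zmod_closed (B1_at n).
Proof.
have [c0 cB] := coboundary_zmod_closed (Gal_over (Q_ p n)).
by split=> [|b c /asboolP bB /asboolP cB']; apply/asboolP; [|apply: cB].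
Qed.
HB.instance Definition _ n :=
  GRing.isZmodClosed.Build (absGal -> A_mod) (B1_at n) (B1_at_zmod_closed n).

Lemma B1_at_incr n m c : (n <= m)%N -> c \in B1_at n -> c \in B1_at m.
Proof.
move=> nm /asboolP[a ca]; apply/asboolP; exists a => s Ls; apply: ca.
by move=> x /(Q_incr nm)/Ls.
Qed.

Definition B1_infty : {pred absGal -> A_mod} :=
  fun c => `[< exists n, c \in B1_at n >].

Lemma B1_infty_zmod_closed : zmod_closed B1_infty.
Proof.
split=> [|b c /asboolP[n bn] /asboolP[m cm]]; apply/asboolP.
  by exists 0%N; apply: rpred0.
exists (maxn n m); apply: rpredB.
  exact: B1_at_incr (leq_maxl n m) bn.
exact: B1_at_incr (leq_maxr n m) cm.
Qed.
HB.instance Definition _ :=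
  GRing.isZmodClosed.Build (absGal -> A_mod) B1_infty B1_infty_zmod_closed.

(* A cochain on Gal(Q_Sigma/Q_n) is a function absGal -> A(phi), of which only
   the values on Gal_over (Q_ p n) matter, as B1_at n contains all functions
   vanishing there. So H^1(Q_Sigma/Q_n, A(phi)) is the subgroup of
   cochains_at n formed by the classes of cocycles. *)
Definition cochains_at (n : nat) : zmodType := {ideal_quot (B1_at n)}.

Variable S : seq nat.

Definition H1_at (n : nat) : set (cochains_at n) :=
  proj (B1_at n) @` cocycle A_act (Q_Sigma S) (Gal_over (Q_ p n)).
Arguments H1_at n : clear implicits.

(* P0 is the prime of the ring of algebraic integers above p determined by the
   fixed embedding. At l != p, the condition does not depend on the prime of
   algC chosen above the given prime of Q_n, and is imposed for all of them. *)
Variable P0 : set algC.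

Definition selmer_condition (n : nat) : set (absGal -> A_mod) :=
  [set c | (forall l P, l \in S -> l != p -> prime_above l P ->
     coboundary A_act (inertia P `&` Gal_over (Q_ p n)) c) /\
     coboundary A_minus_act (inertia P0 `&` Gal_over (Q_ p n))
       (fun s => proj A_plus (c s))].

Definition Sel_at (n : nat) : set (cochains_at n) :=
  H1_at n `&` proj (B1_at n) @` selmer_condition n.
Arguments Sel_at n : clear implicits.

(* Restriction from Q_n to Q_m, for n <= m, is induced by the identity on
   cochains, so the direct limit of the groups cochains_at n is the quotient of
   absGal -> A(phi) by the union of the B1_at n; see res_infty_eq below. *)
Definition restr_at (n m : nat) (x : cochains_at n) : cochains_at m :=
  proj (B1_at m) (repr x).

Definition cochains_infty : zmodType := {ideal_quot B1_infty}.

Definition res_infty (n : nat) (x : cochains_at n) : cochains_infty :=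
  proj B1_infty (repr x).

Lemma restr_at_proj n m c :
  (n <= m)%N -> restr_at m (proj (B1_at n) c) = proj (B1_at m) c.
Proof. by move=> nm; apply/proj_eq/(B1_at_incr nm)/repr_proj. Qed.

Lemma res_infty_proj n c : res_infty (proj (B1_at n) c) = proj B1_infty c.
Proof. by apply/proj_eq/asboolP; exists n; apply: repr_proj. Qed.

Lemma res_infty_eq n m (x : cochains_at n) (y : cochains_at m) :
  res_infty x = res_infty y <->
  exists k, [/\ (n <= k)%N, (m <= k)%N & restr_at k x = restr_at k y].
Proof.
rewrite /res_infty /restr_at proj_eq; split=> [/asboolP[k xy]|[k [_ _]]].
  exists (maxn k (maxn n m)); rewrite !leq_max !leqnn !orbT; split=> //.
  by apply/proj_eq; apply: B1_at_incr xy; rewrite leq_maxl.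
by move=> /proj_eq xy; apply/asboolP; exists k.
Qed.

Definition Sel_infty : set cochains_infty :=
  \bigcup_n (@res_infty n @` Sel_at n).

Definition gamma_act (g : absGal) (y : cochains_infty) : cochains_infty :=
  proj B1_infty (conj_cochain A_act g (repr y)).

Definition Sel_infty_inv (n : nat) : set cochains_infty :=
  [set y | Sel_infty y /\ forall g, Gamma_ p n g -> gamma_act g y = y].

End SelmerGroups.

Arguments H1_at {p p_pr K} kC {F d rho} T phi S n.
Arguments Sel_at {p p_pr K} kC {F d rho} T phi Vp S P0 n.
Arguments restr_at {p p_pr K kC F d rho T phi n} m x.
Arguments res_infty {p p_pr K kC F d rho T phi} n x.
Arguments Sel_infty {p p_pr K} kC {F d rho} T phi Vp S P0.
Arguments Sel_infty_inv {p p_pr K} kC {F d rho} T phi Vp S P0 n.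

(* Main.v *)
From HB Require Import structures.
Require Import Defs.
From mathcomp Require Import all_boot all_order all_fingroup all_algebra.
From mathcomp Require Import all_solvable all_field all_character.
From mathcomp Require Import ring.
From mathcomp Require Import boolp classical_sets functions cardinality filter.

Set Implicit Arguments.
Unset Strict Implicit.
Unset Printing Implicit Defensive.

Import Order.TTheory GRing.Theory Num.Theory.
Local Open Scope classical_set_scope.
Local Open Scope ring_scope.

                                                                                 
                                                                               
                                                                                  
                                                                                 
                                                                                 
                                                     
                                                                                 
                                                                                
                                                                                 
                                                                                
                                                          
                                                                            
                                                                               
                      
                                                                                 
                                                                                
                                                                                 

                                            

(** The restriction map is bijective, so the cokernel has one element and 1 is the uniform bound.
    Write H_n for the Galois group over Q_n and D for the decomposition group of [P0] inside Delta.

    Everything rests on one construction. Because p does not divide |Delta|, each g in D lifts to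
    some h in the decomposition group of [P0] that is trivial on Q_infty ([lift_decomposition]). To
    get h, lift g to some s ([decomposition_lift]) and take a limit of powers s^(p^q) with p^q = 1
    modulo |Delta| ([prime_to_p_part]): on K these powers agree with s, while in the limit the pro-p
    part of the action on p-power roots of unity dies. The character phi is 1 on h, so h acts on
    A(phi) as g acts on A. As V has no D-invariants, the sum over D kills V, hence also A and A^-;
    and |D| is invertible in O.

    Global consequence: an element of A(phi) fixed by H_n is killed by |D|, hence is 0 ([A_inv0]).
    Inflation-restriction, done on cocycles, then shows that restriction from Q_n to Q_m is
    injective on H^1 ([coboundary_of_restriction]) and that an invariant class over Q_m comes from
    Q_n ([cocycle_extension]). Invariance is given for automorphisms that act on Q_infty as p^n-th
    powers; [Gal_Q_decompose] reaches all of H_n from these and H_m.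

    Local consequence: the extended cocycle still satisfies the Selmer conditions. At l != p,
    inertia is trivial on the p-power roots of unity ([inertia_mu]), so the inertia groups over Q_n
    and Q_m coincide. At p, the lifts of D commute with inertia up to inertia over Q_m, and
    averaging the cocycle identity over them shows that a class that dies over Q_m already dies over
    Q_n ([local_coboundary]).

    The foundations are these: [P0] is a prime because the integral closure of Z_p is local
    ([val_ring_unit_or_nilpotent]); the Galois group is compact ([absGal_cluster]); and integers
    close to 1 have p-power roots modulo p^k ([nat_root_pXth]), which controls the layers Q_n. *)

(** * Completeness and separatedness of Z_p *)

Section PadicCompleteness.

Variables (p : nat) (p_pr : prime p).
Local Notation Z_p := (Defs.Zp p_pr).

Lemma residue_nat (a : nat) n : residue (a%:R : Z_p) n = (a%:Z %% (p ^ n)%N)%Z.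
Proof.
elim: a n => [|a IHa] n; first by [].
by rewrite -[a.+1%:R]natr1 /= IHa modzDml modzDmr -addn1 PoszD.
Qed.

Lemma residueB (x y : Z_p) n :
  residue (x - y) n = ((residue x n - residue y n) %% (p ^ n)%N)%Z.
Proof. by rewrite /= modzDmr. Qed.

Lemma residueD (x y : Z_p) n :
  residue (x + y) n = ((residue x n + residue y n) %% (p ^ n)%N)%Z.
Proof. by []. Qed.

(** The quotient is read off from shifted residues: modulo p^n it is the residue of x modulo
    p^(n+k), divided by p^k. *)
Lemma Zp_dvd_exp (x : Z_p) k :
  residue x k = 0 -> exists y, x = p%:R ^+ k * y.
Proof.
move=> xk0; pose f n := (residue x (n + k) %/ (p ^ k)%N)%Z.
have pk0 n : ((p ^ n)%N%:Z != 0) by rewrite eqz_nat -lt0n expn_gt0 prime_gt0.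
have fE n : f n * (p ^ k)%N = residue x (n + k).
  apply/divzK/dvdz_mod0P; have := residue_le x (leq_addl n k).
  by rewrite xk0 mod0z => ->.
have fP n : (f n.+1 = f n %[mod (p ^ n)%N])%Z.
  apply/eqP; rewrite eqz_mod_dvd -(dvdz_mul2r (pk0 k)).
  rewrite mulrBl !fE -PoszM -expnD -eqz_mod_dvd; apply/eqP.
  by rewrite addSn residue_modS.
exists (Zp_of p_pr fP); apply: Zp_eq => n.
have -> : (p%:R : Z_p) ^+ k = (p ^ k)%N%:R by rewrite natrX.
rewrite [RHS]/= residue_nat modzMm -[LHS]residue_mod.
rewrite -(residue_le x (leq_addr k n)) -fE mulrC.
by [].
Qed.

Lemma residue_expM (x : Z_p) k : residue (p%:R ^+ k * x) k = 0.
Proof.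
by rewrite -natrX /= residue_nat modzz mul0r mod0z.
Qed.

Lemma Zp_separated (x : Z_p) :
  (forall k, exists t, x = p%:R ^+ k * t) -> x = 0.
Proof.
move=> xp; apply: Zp_eq => k; have [t ->] := xp k.
by rewrite residue_expM /= mod0z.
Qed.

(** The residues modulo p^n of the n-th partial sums are compatible, which defines the sum;
    [Zp_dvd_exp] divides each tail. *)
Lemma Zp_series (w : nat -> Z_p) : exists s, forall k, exists t,
  s = \sum_(i < k) p%:R ^+ i * w i + p%:R ^+ k * t.
Proof.
pose W n := \sum_(i < n) p%:R ^+ i * w i.
have fP n : (residue (W n.+1) n.+1 = residue (W n) n %[mod (p ^ n)%N])%Z.
  rewrite residue_modS /W big_ord_recr residueD.
  by rewrite residue_expM addr0 modz_mod.
exists (Zp_of p_pr fP) => k; have [|t st] := @Zp_dvd_exp (Zp_of p_pr fP - W k) k.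
  by rewrite residueB /= residue_mod subrr mod0z.
by exists t; rewrite -/(W k) -st addrC subrK.
Qed.

Lemma Zp_dvd_of_pow (c z : Z_p) n : c ^+ n = p%:R * z -> exists c', c = p%:R * c'.
Proof.
move=> cz; have [|c' ->] := @Zp_dvd_exp c 1; last by exists c'; rewrite expr1.
have : residue (c ^+ n) 1 = 0 by rewrite cz -{1}[p%:R]expr1 residue_expM.
have -> : residue (c ^+ n) 1 = (residue c 1 ^+ n %% (p ^ 1)%N)%Z.
  elim: n {cz} => [|n IHn] //=.
  by rewrite exprS [LHS]/= IHn modzMmr exprS.
move=> /dvdz_mod0P; rewrite dvdzE expn1 absz_nat abszX Euclid_dvdX //.
case/andP=> pc _.
rewrite -[LHS]residue_mod; apply/dvdz_mod0P.
by rewrite dvdzE expn1 absz_nat.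
Qed.

Lemma Zp_p_neq0 : p%:R != 0 :> Z_p.
Proof.
apply/eqP => /(congr1 (fun x : Z_p => residue x 2)); rewrite residue_nat.
rewrite [RHS]/= mod0z modz_small ?ltz_nat -?mulnn ?ltn_Pmulr ?prime_gt0 ?prime_gt1 //.
by move=> [p0]; have := prime_gt0 p_pr; rewrite p0.
Qed.

End PadicCompleteness.

(** * Units and idempotents in p-adically complete domains *)

Section AdicallyComplete.

(** [R] is a subring given as a set, so that it can be instantiated with Z_p[y] inside a field.
    Completeness is stated for power series in p. *)
Variables (D : idomainType) (p : nat) (R : set D).
Hypotheses (R1 : R 1) (RB : forall x y, R x -> R y -> R (x - y))
  (RM : forall x y, R x -> R y -> R (x * y)).
Hypothesis R_complete : forall w : nat -> D, (forall i, R (w i)) ->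
  exists2 s, R s & forall k, exists2 t, R t &
    s = \sum_(i < k) p%:R ^+ i * w i + p%:R ^+ k * t.
Hypothesis R_separated : forall x,
  (forall k, exists2 t, R t & x = p%:R ^+ k * t) -> x = 0.

Let R0 : R 0. Proof. by rewrite -(subrr 1); apply: RB. Qed.
Let RN x : R x -> R (- x). Proof. by move=> Rx; rewrite -sub0r; apply: RB. Qed.
Let RD x y : R x -> R y -> R (x + y).
Proof. by move=> Rx Ry; rewrite -[y]opprK; apply/RB/RN. Qed.
Let RX x n : R x -> R (x ^+ n).
Proof. by move=> Rx; elim: n => [|n IHn]; rewrite ?expr0 // exprS; apply: RM. Qed.
Let Rn n : R n%:R.
Proof. by elim: n => [|n IHn] //; rewrite -natr1; apply: RD. Qed.

(** The inverse is the geometric series in p r. *)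
Lemma adic_inverse r : R r -> exists2 s, R s & (1 - p%:R * r) * s = 1.
Proof.
move=> Rr; have [s Rs sP] := R_complete (fun i => RX i Rr).
exists s => //; apply/eqP; rewrite -subr_eq0; apply/eqP/R_separated => k.
have [t Rt ->] := sP k; exists ((1 - p%:R * r) * t - r ^+ k).
  by apply: RB; [apply: RM => //; apply: RB => //; apply: RM|apply: RX].
under eq_bigr do rewrite -exprMn.
set q := p%:R * r; have -> : p%:R ^+ k * ((1 - q) * t - r ^+ k) =
    p%:R ^+ k * (1 - q) * t - q ^+ k by rewrite /q exprMn; ring.
rewrite mulrDr -(opprB q 1) mulNr -subrX1; ring.
Qed.

(** Newton iteration: x -> 3x^2 - 2x^3 replaces the defect x^2 - x by a multiple of its square, so
    the iterates of e converge to a true idempotent congruent to e modulo p. In a domain this is 0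
    or 1. *)
Lemma adic_idempotent e r : R e -> R r -> e * e - e = p%:R * r ->
  exists2 t, R t & e = p%:R * t \/ e = 1 - p%:R * t.
Proof.
move=> Re Rr er; pose u x : D := 3%:R * x ^+ 2 - 2%:R * x ^+ 3.
pose E k := iter k u e.
have RE k : R (E k).
  by elim: k => //= k IHk; apply: RB; apply: RM => //; apply: RX.
have dE k : exists2 t, R t & E k * E k - E k = p%:R ^+ k.+1 * t.
  elim: k => [|k [t Rt IHk]]; first by exists r; rewrite ?expr1.
  exists (p%:R ^+ k * t ^+ 2 * (4%:R * (E k) ^+ 2 - 4%:R * E k - 3%:R)).
    apply: RM; first by apply: RM; apply: RX.
    by apply: RB => //; apply: RB; apply: RM => //; apply: RX.
  have -> : E k.+1 * E k.+1 - E k.+1 =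
      (E k * E k - E k) ^+ 2 * (4%:R * (E k) ^+ 2 - 4%:R * E k - 3%:R).
    by rewrite /E iterS /u; ring.
  by rewrite IHk !exprS; ring.
have sE k : exists t, R t /\ E k.+1 - E k = p%:R ^+ k.+1 * t.
  have [t Rt tE] := dE k; exists (t * (1 - 2%:R * E k)); split.
    by apply: RM => //; apply: RB => //; apply: RM.
  by rewrite mulrA -tE /E iterS /u; ring.
have [w wE] := choice sE.
(* The series telescopes: its first k+1 terms add up to [E k]. *)
pose w' k := if k is k.+1 then w k else e.
have [|s Rs sP] := R_complete (w := w'); first by case=> [|k] //=; case: (wE k).
have EP k : \sum_(i < k.+1) p%:R ^+ i * w' i = E k.
  elim: k => [|k IHk]; first by rewrite big_ord1 mul1r.
  by rewrite big_ord_recr /= IHk -(wE k).2 addrC subrK.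
have s_idem : s * s - s = 0.
  apply: R_separated => k; have [t Rt ->] := sP k.+1; rewrite EP.
  have [d Rd dk] := dE k.
  exists (p%:R * (d + 2%:R * E k * t + p%:R ^+ k.+1 * t ^+ 2 - t)).
    apply: RM => //; apply: RB => //; apply: RD.
      by apply: RD => //; apply: RM => //; apply: RM.
    by apply: RM; apply: RX.
  rewrite mulrA -exprSr -[_ * (_ - t)]/(_ * (d + _ + _ - t)).
  by rewrite [RHS]mulrBr !mulrDr -dk; ring.
have [t Rt sE1] := sP 1; rewrite EP expr1 /E /= in sE1.
move/eqP: s_idem; rewrite -{3}[s]mulr1 -mulrBr mulf_eq0 subr_eq0.
case/orP=> /eqP s01; [exists (- t); first exact: RN; left|exists t => //; right].
  by apply/eqP; rewrite mulrN -addr_eq0 -sE1 s01.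
by apply/eqP; rewrite eq_sym subr_eq -sE1 s01.
Qed.

(** The relation makes y^(d i) idempotent modulo p, so y^(d i) lies in pR or in 1 + pR; in the
    second case it is invertible, and y with it. *)
Lemma unit_or_nilpotent_mod y i d r : R y -> R r -> (0 < i)%N -> (0 < d)%N ->
  y ^+ i * (y ^+ d - 1) = p%:R * r ->
  (exists2 s, R s & y * s = 1) \/ (exists N, exists2 s, R s & y ^+ N = p%:R * s).
Proof.
move=> Ry Rr i0 d0 yr.
have [|||t Rt] := @adic_idempotent (y ^+ (d * i))
    (r * y ^+ ((d.-1) * i) * \sum_(k < i) (y ^+ d) ^+ k); first exact: RX.
- apply: RM; first by apply: RM => //; apply: RX.
  by elim/big_rec: _ => // k x _ Rx; apply: RD => //; do 2 apply: RX.
- rewrite -{3}[y ^+ (d * i)]mulr1 -mulrBr {2}exprM subrX1 -{1}(prednK d0) mulSn.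
  by rewrite exprD !mulrA -yr; ring.
have yS : y ^+ (d * i) = y * y ^+ (d * i).-1 by rewrite -exprS prednK ?muln_gt0 ?d0.
case=> E; first by right; exists (d * i)%N, t.
left; have [s Rs sE] := adic_inverse Rt; exists (y ^+ (d * i).-1 * s).
  by apply: RM => //; apply: RX.
by rewrite mulrA -yS E.
Qed.

End AdicallyComplete.

(** By Bezout a n = 1 + b p, and 1 + b p is inverted by a geometric series. *)
Lemma Zp_coprime_inv (p : nat) (p_pr : prime p) (n : nat) :
  ~~ (p %| n)%N -> exists y : Defs.Zp p_pr, y * n%:R = 1.
Proof.
move=> pn; have n0 : (0 < n)%N by case: posnP pn => // ->; rewrite dvdn0.
have copn : gcdn n p = 1%N by apply/eqP; rewrite -/(coprime _ _) coprime_sym prime_coprime.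
case: (egcdnP p n0) => a b abE _; rewrite copn in abE.
have Zp_complete (w : nat -> Defs.Zp p_pr) : (forall i, [set: Defs.Zp p_pr] (w i)) ->
    exists2 s, [set: Defs.Zp p_pr] s & forall k, exists2 t, [set: Defs.Zp p_pr] t &
      s = \sum_(i < k) p%:R ^+ i * w i + p%:R ^+ k * t.
  move=> _; have [s sP] := Zp_series w; exists s => // k.
  by have [t tP] := sP k; exists t.
have Zp_sep (x : Defs.Zp p_pr) :
    (forall k, exists2 t, [set: Defs.Zp p_pr] t & x = p%:R ^+ k * t) -> x = 0.
  by move=> xp; apply: Zp_separated => k; have [t _] := xp k; exists t.
have [//|//|//|s _ sE] := adic_inverse _ _ _ Zp_complete Zp_sep (I : setT (- b%:R)).
exists (s * a%:R); rewrite -mulrA -natrM abE natrD natrM -[RHS]sE.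
by rewrite mulrN opprK mulrC addrC [b%:R * _]mulrC.
Qed.

(** * The integral closure of Z_p is local, and the embedding defines a prime above p *)

Section ValuationRingLocal.

Variables (p : nat) (p_pr : prime p) (E : fieldType) (j : {rmorphism Qp p_pr -> E}).
Local Notation Z_p := (Defs.Zp p_pr).
Local Notation iZ := (j \o @tofrac Z_p).
Local Notation A := (val_ring j).

Let iZM x y : iZ (x * y) = iZ x * iZ y. Proof. exact: (rmorphM iZ). Qed.
Let iZX x n : iZ (x ^+ n) = iZ x ^+ n. Proof. exact: (rmorphXn iZ). Qed.
Let iZn n : iZ n%:R = n%:R. Proof. exact: (rmorph_nat iZ). Qed.
Let iZ0 : iZ 0 = 0. Proof. exact: (rmorph0 iZ). Qed.
Let iZD x y : iZ (x + y) = iZ x + iZ y. Proof. exact: (rmorphD iZ). Qed.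
Let iZN x : iZ (- x) = - iZ x. Proof. exact: (rmorphN iZ). Qed.
Let iZ1 : iZ 1 = 1. Proof. exact: (rmorph1 iZ). Qed.
Let iZ_sum n (F : 'I_n -> Z_p) : iZ (\sum_i F i) = \sum_i iZ (F i).
Proof. exact: (rmorph_sum iZ). Qed.

Let iZ_inj : injective iZ.
Proof. by move=> x y /fmorph_inj/eqP; rewrite tofrac_eq => /eqP. Qed.

Let p_neq0 : p%:R != 0 :> E.
Proof. by rewrite -(rmorph_nat iZ) fmorph_eq0 tofrac_eq0 Zp_p_neq0. Qed.

Lemma val_ring1 : A 1. Proof. exact: (integral1 iZ). Qed.
Lemma val_ringB x y : A x -> A y -> A (x - y).
Proof. exact: (@integral_sub _ _ iZ). Qed.
Lemma val_ringM x y : A x -> A y -> A (x * y).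
Proof. exact: (@integral_mul _ _ iZ). Qed.
Lemma val_ring_Zp c : A (iZ c).
Proof. exact: (integral_id iZ). Qed.
Lemma val_ring_horner (q : {poly Z_p}) x : A x -> A (map_poly iZ q).[x].
Proof.
move=> Ax; apply: (integral_horner (RtoK := iZ)) => // _ /(nthP 0)[i _ <-].
by rewrite coef_map; apply: val_ring_Zp.
Qed.
Lemma val_ringX x n : A x -> A (x ^+ n).
Proof.
by move=> Ax; elim: n => [|n IHn]; rewrite ?expr0 ?exprS; [exact: val_ring1|apply: val_ringM].
Qed.

Lemma val_ring_coprime_inv n : ~~ (p %| n)%N -> exists2 u : E, A u & u * n%:R = 1.
Proof.
move=> /(Zp_coprime_inv p_pr)[y yn]; exists (iZ y); first exact: val_ring_Zp.
by rewrite -iZn -iZM yn iZ1.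
Qed.

(** Multiplying a monic equation of u, of degree n, by p^n shows that p divides c^n in Z_p. *)
Lemma val_ring_dvdp (c : Z_p) u : A u -> iZ c = p%:R * u -> exists c', c = p%:R * c'.
Proof.
case=> f f_mon fu0 cu; set n := (size f).-1.
have f_lead : f`_n = 1 by apply/monicP.
have szf : size f = n.+1 by rewrite prednK // lt0n size_poly_eq0 monic_neq0.
have : \sum_(i < n.+1) f`_i * c ^+ i * p%:R ^+ (n - i) = 0.
  apply: iZ_inj; rewrite iZ0 iZ_sum.
  transitivity (p%:R ^+ n * (map_poly iZ f).[u]); last first.
    by rewrite (rootP fu0) mulr0.
  rewrite horner_poly szf mulr_sumr; apply: eq_bigr => i _.
  have in_ : (i <= n)%N by rewrite -ltnS.
  rewrite !iZM !iZX iZn cu exprMn.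
  have -> : p%:R ^+ n = p%:R ^+ (n - i) * p%:R ^+ i :> E by rewrite -exprD subnK.
  ring.
rewrite big_ord_recr /= f_lead subnn expr0 mulr1 mul1r => /eqP.
rewrite addrC addr_eq0 => /eqP cn.
apply: (@Zp_dvd_of_pow _ _ c (- \sum_(i < n) f`_i * c ^+ i * p%:R ^+ (n - i).-1) n).
rewrite cn mulrN mulr_sumr; congr (- _); apply: eq_bigr => i _.
by rewrite -(prednK (_ : 0 < n - i)%N) ?subn_gt0 // exprS [in LHS]mulrCA.
Qed.

Lemma val_ring_dvdpX (c : Z_p) k u :
  A u -> iZ c = p%:R ^+ k * u -> exists c', c = p%:R ^+ k * c'.
Proof.
move=> Au; elim: k c => [|k IHk] c cu; first by exists c; rewrite mul1r.
have [||c' cE] := @val_ring_dvdp c (p%:R ^+ k * u).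
- by apply: val_ringM => //; apply: val_ringX; rewrite -iZn; apply: val_ring_Zp.
- by rewrite cu exprS mulrA.
have [|d dE] := IHk c'; last by exists d; rewrite cE dE exprS mulrA.
by apply: (mulfI p_neq0); rewrite -{1}iZn -iZM -cE cu exprS mulrA.
Qed.

(** The constant term of an equation of x is a multiple of x; as x is nonzero, factors X can be
    removed until that term is nonzero. *)
Lemma val_ring_dvd_const x : A x -> x != 0 ->
  exists2 c : Z_p, c != 0 & exists2 y, A y & iZ c = x * y.
Proof.
move=> Ax x0; have [f f_mon] := Ax.
have := monic_neq0 f_mon; move: {f_mon}f.
suff H n : forall f : {poly Z_p}, (size f <= n)%N -> f != 0 ->
    root (map_poly iZ f) x -> exists2 c : Z_p, c != 0 & exists2 y, A y & iZ c = x * y.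
  by move=> f; apply: H (leqnn _).
elim: n => [|n IHn] f; first by rewrite leqn0 size_poly_eq0 => ->.
elim/poly_ind: f => [|g c _]; first by rewrite eqxx.
rewrite -cons_poly_def size_cons_poly; case: (altP (c =P 0)) => [->|c0]; last first.
  move=> _ _; rewrite cons_poly_def !rmorphD /= rmorphM /= map_polyX map_polyC /=.
  rewrite rootE !hornerE addrC addr_eq0 => /eqP cx; exists c => //.
  exists (- (map_poly iZ g).[x]); last by rewrite mulrN mulrC -[RHS]cx.
  rewrite -sub0r; apply: val_ringB; last exact: val_ring_horner.
  by rewrite -iZ0; apply: val_ring_Zp.
rewrite andbT; case: nilP => [g0|_].
  have -> : g = 0 by apply: val_inj; rewrite /= g0 polyseq0.
  by rewrite cons_poly_def addr0 mul0r eqxx.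
rewrite ltnS cons_poly_def addr0 => sg gX0.
rewrite rmorphM /= map_polyX rootM rootX (negPf x0) orbF; apply: IHn => //.
by apply: contraNneq gX0 => ->; rewrite mul0r.
Qed.

(** A nonzero x would divide a nonzero c of Z_p, and divisibility of c by every p^k descends to
    Z_p. *)
Lemma val_ring_separated x :
  (forall k, exists2 t, A t & x = p%:R ^+ k * t) -> x = 0.
Proof.
move=> xp; apply/eqP/negPn/negP => x0.
have Ax : A x by have [t At ->] := xp 0; rewrite mul1r.
have [c c0 [y Ay cE]] := val_ring_dvd_const Ax x0.
case/eqP: c0; apply: Zp_separated => k; have [t At xt] := xp k.
by apply: (@val_ring_dvdpX _ _ (t * y)); [apply: val_ringM|rewrite cE xt mulrA].
Qed.

(** The ring Z_p[y] is finitely generated over Z_p, hence p-adically complete, and two powers of y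
    agree modulo p by the pigeonhole principle; [unit_or_nilpotent_mod] concludes. This replaces the
    extension of the valuation. *)
Lemma val_ring_unit_or_nilpotent y : A y ->
  (exists2 s, A s & y * s = 1) \/ (exists N, exists2 s, A s & y ^+ N = p%:R * s).
Proof.
move=> Ay; have [f f_mon fy0] := Ay; set n := (size f).-1.
have szf : size f = n.+1 by rewrite prednK // lt0n size_poly_eq0 monic_neq0.
(* This is Z_p[y]. Coordinates give completeness; [R_horner] and [R_poly] pass to polynomial
   expressions, which give the ring operations. *)
pose R : set E := [set x | exists c : nat -> Z_p, x = \sum_(l < n) iZ (c l) * y ^+ l].
have R_horner q : R (map_poly iZ q).[y].
  exists (fun l => (Pdiv.Ring.rmodp q f)`_l).
  rewrite {1}(Pdiv.RingMonic.rdivp_eq f_mon q) rmorphD rmorphM /= hornerD hornerM.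
  rewrite (rootP fy0) mulr0 add0r; set r := Pdiv.Ring.rmodp q f.
  have szr : (size r <= n)%N by rewrite -ltnS -szf Pdiv.Ring.ltn_rmodpN0 ?monic_neq0.
  rewrite (horner_coef_wide _ (leq_trans (size_poly _ _) szr)).
  by apply: eq_bigr => l _; rewrite coef_map.
have R_poly x : R x -> exists q, x = (map_poly iZ q).[y].
  case=> c ->; exists (\poly_(l < n) c l).
  rewrite (@horner_coef_wide _ n); last first.
    exact: leq_trans (size_poly _ _) (size_poly _ _).
  by apply: eq_bigr => l _; rewrite coef_map coef_poly ltn_ord.
have RA x : R x -> A x by move=> /R_poly[q ->]; apply: val_ring_horner.
have R1 : R 1 by rewrite -(hornerC 1 y) -[1%:P](rmorph1 (map_poly iZ)); apply: R_horner.
have RB x z : R x -> R z -> R (x - z).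
  by move=> /R_poly[q ->] /R_poly[r ->]; rewrite -hornerN -hornerD -rmorphB; apply: R_horner.
have RM x z : R x -> R z -> R (x * z).
  by move=> /R_poly[q ->] /R_poly[r ->]; rewrite -hornerM -rmorphM; apply: R_horner.
have Ry : R y by rewrite -[y]hornerX -(map_polyX iZ); apply: R_horner.
have R_complete : forall w : nat -> E, (forall i, R (w i)) ->
    exists2 s, R s & forall k, exists2 t, R t &
      s = \sum_(i < k) p%:R ^+ i * w i + p%:R ^+ k * t.
  move=> w /choice[c wE].
  have /choice[s sP] (l : nat) := Zp_series (c^~ l).
  exists (\sum_(l < n) iZ (s l) * y ^+ l); first by exists s.
  move=> k; have /choice[t tP] (l : nat) := sP l k.
  exists (\sum_(l < n) iZ (t l) * y ^+ l); first by exists t.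
  rewrite mulr_sumr; under [X in _ = X + _]eq_bigr do rewrite wE mulr_sumr.
  rewrite exchange_big -big_split; apply: eq_bigr => l _ /=.
  rewrite -/(iZ (s l)) -/(iZ (t l)) tP iZD mulrDl iZM iZX iZn mulrA; congr (_ + _).
  rewrite iZ_sum mulr_suml; apply: eq_bigr => i _.
  by rewrite iZM iZX iZn mulrA.
have R_sep x : (forall k, exists2 t, R t & x = p%:R ^+ k * t) -> x = 0.
  by move=> xp; apply: val_ring_separated => k; have [t /RA] := xp k; exists t.
have RX k : R (y ^+ k) by elim: k => [|k IHk]; rewrite ?expr0 // exprS; apply: RM.
have /choice[c cP] (k : nat) := RX k.+1.
(* The tuple [g k] holds the coordinates of y^(k+1) modulo p; there is one more exponent than there
   are tuples. The successor in ['I_p.+1] is there for [inord]. *)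
pose g (k : 'I_#|{ffun 'I_n -> 'I_p.+1}|.+1) : {ffun 'I_n -> 'I_p.+1} :=
  [ffun l : 'I_n => inord `|residue (c k l) 1|%N].
have /injectivePn[k1 [k2 k12 gk]] : ~~ injectiveb g.
  by apply/negP => /injectiveP/leq_card; rewrite card_ord ltnn.
wlog {k12} lt12 : k1 k2 gk / (k1 < k2)%N.
  by move=> H; have := k12; rewrite neq_ltn => /orP[]; apply: H; rewrite ?gk.
have resP (x : Z_p) : (0 <= residue x 1) && (residue x 1 < p%:Z).
  have p0 : 0 < p%:Z :> int by rewrite ltz_nat prime_gt0.
  by rewrite -[residue x 1]residue_mod expn1 modz_ge0 ?ltz_pmod ?gt_eqF.
have /choice[d dP] (l : 'I_n) : exists d, c k2 l - c k1 l = p%:R * d.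
  have [|d ->] := @Zp_dvd_exp _ _ (c k2 l - c k1 l) 1; last by exists d; rewrite expr1.
  move/ffunP/(_ l): gk; rewrite !ffunE => /(congr1 val).
  have [/andP[c10 c1p] /andP[c20 c2p]] := (resP (c k1 l), resP (c k2 l)).
  rewrite /= !inordK; try by rewrite ltnS ltnW // -ltz_nat gez0_abs.
  move=> /(congr1 Posz); rewrite !gez0_abs // => e.
  by rewrite -e modzDmr subrr mod0z.
have d0 : (0 < k2 - k1)%N by rewrite subn_gt0.
pose r := \sum_(l < n) iZ (d l) * y ^+ l.
have Rr : R r.
  exists (fun l => if insub l is Some l' then d l' else 0).
  by apply: eq_bigr => l _; rewrite valK.
have yr : y ^+ k1.+1 * (y ^+ (k2 - k1) - 1) = p%:R * r.
  rewrite mulrBr mulr1 -exprD addSn subnKC; last exact: ltnW.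
  rewrite (cP k2) (cP k1) -sumrB mulr_sumr.
  by apply: eq_bigr => l _; rewrite -mulrBl -iZN -iZD dP iZM iZn mulrA.
case: (unit_or_nilpotent_mod R1 RB RM R_complete R_sep Ry Rr (ltn0Sn k1) d0 yr).
  by move=> [s /RA As ys]; left; exists s.
by move=> [N [s /RA As yN]]; right; exists N, s.
Qed.

Lemma p_not_unit r : A r -> p%:R * r <> 1.
Proof.
move=> Ar pr1; have /eqP := oner_neq0 E; apply; apply: val_ring_separated => k.
by exists (r ^+ k); [exact: val_ringX|rewrite -exprMn pr1 expr1n].
Qed.

(** Otherwise some power of 1 - p r is divisible by p, whereas all its powers are 1 modulo p. *)
Let unit1B r : A r -> exists2 s, A s & (1 - p%:R * r) * s = 1.
Proof.
have Ap : A p%:R by rewrite -iZn; apply: val_ring_Zp.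
move=> Ar; have [|//|[N [s As sN]]] := @val_ring_unit_or_nilpotent (1 - p%:R * r).
  by apply: val_ringB; [exact: val_ring1|apply: val_ringM].
exfalso; have [q Aq /eqP] : exists2 q, A q & (1 - p%:R * r) ^+ N = 1 - p%:R * q.
  elim: N {sN} => [|N [q Aq IHN]].
    by exists 0; [rewrite -iZ0; apply: val_ring_Zp|rewrite mulr0 subr0].
  exists (r + (1 - p%:R * r) * q); last by rewrite exprS IHN; ring.
  rewrite -[_ * q]opprK; apply: val_ringB => //; rewrite -sub0r.
  apply: val_ringB; first by rewrite -iZ0; apply: val_ring_Zp.
  by apply: val_ringM => //; apply: val_ringB; [exact: val_ring1|apply: val_ringM].
rewrite sN eq_sym subr_eq -mulrDr => /eqP/esym; apply: p_not_unit.
rewrite -[s + q]opprK opprD -sub0r; apply: val_ringB.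
  by rewrite -iZ0; apply: val_ring_Zp.
apply: val_ringB => //; rewrite -sub0r; apply: val_ringB => //.
by rewrite -iZ0; apply: val_ring_Zp.
Qed.

Local Notation m := (val_ideal j).

Lemma val_idealM a x : A a -> m x -> m (a * x).
Proof.
move=> Aa [Ax nux]; split; first exact: val_ringM.
move=> [_ [y Ay axy]]; apply: nux; split=> //; exists (a * y); first exact: val_ringM.
by rewrite mulrA [x * a]mulrC.
Qed.

(** If z inverts x - y, then a = x z is a non-unit, so nilpotent modulo p; hence 1 - a = - y z is a
    unit, and so is y. *)
Lemma val_idealB x y : m x -> m y -> m (x - y).
Proof.
move=> mx my; have [[Ax _] [Ay nuy]] := (mx, my); split; first exact: val_ringB.
move=> [_ [z Az xyz]]; have := val_idealM Az mx; rewrite mulrC; set a := x * z => -[Aa nua].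
have [[s As as1]|[N [s As aN]]] := val_ring_unit_or_nilpotent Aa.
  by apply: nua; split=> //; exists s.
apply: nuy; split=> //; have [t At tE] := unit1B As.
exists (- z * (\sum_(i < N) a ^+ i) * t).
  apply: val_ringM => //; apply: val_ringM.
    by rewrite -sub0r; apply: val_ringB => //; rewrite -iZ0; apply: val_ring_Zp.
  elim/big_rec: _ => [|i u _ Au]; first by rewrite -iZ0; apply: val_ring_Zp.
  rewrite -[u]opprK; apply: val_ringB; first exact: val_ringX.
  by rewrite -sub0r; apply: val_ringB => //; rewrite -iZ0; apply: val_ring_Zp.
have yz : y * - z = 1 - a by rewrite -xyz /a; ring.
rewrite !mulrA yz -[RHS]tE -aN; congr (_ * _).
by rewrite -opprB -[RHS]opprB subrX1 mulNr.
Qed.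

Lemma val_ideal0 : m 0.
Proof.
split; first by rewrite -iZ0; apply: val_ring_Zp.
by move=> [_ [y _]]; rewrite mul0r => /eqP; rewrite eq_sym oner_eq0.
Qed.

Lemma val_ideal_p : m p%:R.
Proof.
split; first by rewrite -iZn; apply: val_ring_Zp.
by move=> [_ [y Ay]]; apply: p_not_unit.
Qed.

Lemma val_ideal1 : ~ m 1.
Proof.
by move=> [A1 []]; split=> //; exists 1; rewrite ?mulr1.
Qed.

Lemma val_ideal_prime x y : A x -> A y -> m (x * y) -> m x \/ m y.
Proof.
move=> Ax Ay [_ nuxy]; have [[_ [x' Ax' xx']]|nux] := pselect (val_units j x); last by left.
right; split=> // -[_ [y' Ay' yy']]; apply: nuxy; split; first exact: val_ringM.
by exists (x' * y'); [exact: val_ringM|rewrite mulrACA xx' yy' mulr1].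
Qed.

Lemma Aint_val_ring (iota : {rmorphism algC -> E}) x : x \in Aint -> A (iota x).
Proof.
move=> /floorpP[q qE]; exists (map_poly intr q).
  apply: monic_map; rewrite monicE -(inj_eq (@intr_inj algC)) -lead_coef_map_inj //.
    by rewrite -qE (monicP (minCpoly_monic x)).
  exact: intr_inj.
rewrite -map_poly_comp /= (eq_map_poly (g := iota \o intr)) => [|a]; last first.
  by rewrite /= !rmorph_int.
by rewrite map_poly_comp -qE fmorph_root root_minCpoly.
Qed.

Lemma prime_of_embedding_above (iota : {rmorphism algC -> E}) :
  Defs.prime_above p (prime_of_embedding j iota).
Proof.
split; last by split; [exact: (Aint_int p)|rewrite rmorph_nat; exact: val_ideal_p].
split=> [x []//||x y [Ax mx] [Ay my]|a x Aa [Ax mx]|[_]|x y Ax Ay [_]].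
- by split; [exact: Aint0|rewrite rmorph0; exact: val_ideal0].
- by split; [exact: rpredB|rewrite rmorphB; exact: val_idealB].
- by split; [exact: rpredM|rewrite rmorphM; apply: val_idealM => //; exact: Aint_val_ring].
- by rewrite rmorph1; exact: val_ideal1.
- rewrite rmorphM => /val_ideal_prime[||mx|my]; try exact: Aint_val_ring.
    by left.
  by right.
Qed.

End ValuationRingLocal.

                                                                       

(** * Compactness of the absolute Galois group *)

Lemma conjugates_finite (x : algC) : exists r : seq algC, forall s : absGal, s x \in r.
Proof.
have [r rE] := closed_field_poly_normal (minCpoly x); exists r => s.
have := root_minCpoly (s x); rewrite minCpoly_aut rE (monicP (minCpoly_monic x)).
by rewrite scale1r root_prod_XsubC.
Qed.

Lemma conjugate_seqs_finite (r : seq algC) :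
  exists L : seq (seq algC), forall s : absGal, map s r \in L.
Proof.
elim: r => [|x r [L LP]]; first by exists [:: [::]] => s; rewrite inE.
have [X XP] := conjugates_finite x.
exists [seq y :: w | y <- X, w <- L] => s; apply/allpairsP.
by exists (s x, map s r); rewrite XP LP.
Qed.

Lemma absGal_finite_orbit (s : absGal) x : exists k, (s ^+ k.+1)%g x = x.
Proof.
have [r rP] := conjugates_finite x.
pose f (k : 'I_(size r).+1) : 'I_(size r).+1 := inord (index ((s ^+ k)%g x) r).
have fP k : (index ((s ^+ k)%g x) r < size r)%N by rewrite index_mem rP.
pose g (k : 'I_(size r).+1) : 'I_(size r) := Ordinal (fP k).
have /injectivePn[k1 [k2 k12 gk]] : ~~ injectiveb g.
  by apply/negP => /injectiveP/leq_card; rewrite !card_ord ltnn.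
wlog {k12} lt12 : k1 k2 gk / (k1 < k2)%N.
  by move=> H; have := k12; rewrite neq_ltn => /orP[]; apply: H; rewrite ?gk.
exists (k2 - k1).-1; rewrite prednK ?subn_gt0 //.
move/(congr1 (fun i : 'I_(size r) => nth 0 r i)): gk; rewrite /= !nth_index ?rP //.
rewrite -{1}(subnKC (ltnW lt12)) expgD absGalM => /fmorph_inj/esym; exact.
Qed.

Lemma ultra_mem_seq (I : Type) (T : eqType) (U : set_system I) (f : I -> T) (r : seq T) :
  UltraFilter U -> U [set i | f i \in r] -> exists y, U [set i | f i = y].
Proof.
move=> UU; elim: r => [|y r IHr] Ur.
  by have := @filter_not_empty _ U _; case; apply: filterS Ur.
have [Uy|Uy] := in_ultra_setVsetC [set i | f i = y] UU; first by exists y.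
apply: IHr; apply: filterS (filterI Ur Uy) => i [/=].
by rewrite inE => /orP[/eqP|].
Qed.

                                                                             
                                                          
(** Along an ultrafilter containing the tails of the net, [u i x] is eventually constant, because x
    has finitely many conjugates. The pointwise limits form a field morphism, as any finite set of
    values is attained by one [u i]. *)
Lemma absGal_cluster (I : Type) (le : I -> I -> Prop) (i0 : I) (u : I -> absGal) :
    (forall i k, exists m, le i m /\ le k m) ->
    (forall i k m, le i k -> le k m -> le i m) ->
  exists t : absGal, forall i (r : seq algC), exists2 k, le i k & {in r, t =1 u k}.
Proof.
move=> le_dir le_trans.
pose F : set_system I := [set A | exists i, forall k, le i k -> A k].
have FF : ProperFilter F.
  apply: Build_ProperFilter_ex.
    by move=> A [i iA]; have [m [im _]] := le_dir i i; exists m; apply: iA.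
  split; first by exists i0.
    move=> A B [i iA] [k kB]; have [m [im km]] := le_dir i k.
    by exists m => l ml; split; [apply: iA|apply: kB]; apply: le_trans ml.
  by move=> A B AB [i iA]; exists i => k /iA/AB.
have [U [UU FU]] := ultraFilterLemma FF.
have /choice[t tP] x : exists y, U [set i | u i x = y].
  have [r rP] := conjugates_finite x; apply: (@ultra_mem_seq _ _ U _ r) => //.
  by apply: filterS filterT => i _; apply: rP.
have tB : zmod_morphism t.
  move=> x y.
  have [i [<- [<- <-]]] := filter_ex (filterI (tP (x - y)) (filterI (tP x) (tP y))).
  by rewrite rmorphB.
have tM : monoid_morphism t.
  split; first by have [i <-] := filter_ex (tP 1); rewrite rmorph1.
  move=> x y.
  have [i [<- [<- <-]]] := filter_ex (filterI (tP (x * y)) (filterI (tP x) (tP y))).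
  by rewrite rmorphM.
exists (AbsGal (conj tB tM)) => i r.
have Ur : U [set k | {in r, t =1 u k}].
  elim: r => [|x r IHr]; first by apply: filterS filterT.
  apply: filterS (filterI (tP x) IHr) => k [/= ux IH] y.
  by rewrite inE => /orP[/eqP ->|/IH].
have Ui : U [set k | le i k] by apply: FU; exists i.
by have [k [ik kr]] := filter_ex (filterI Ui Ur); exists k.
Qed.

(** * Primes of the ring of algebraic integers and Gauss's lemma *)

Section IntPrime.

Variables (P : set algC) (Pprime : int_prime P).

Lemma int_primeN x : P x -> P (- x).
Proof.
by move=> Px; rewrite -sub0r; apply: (int_primeB Pprime); first exact: int_prime0.
Qed.

Lemma int_primeD x y : P x -> P y -> P (x + y).
Proof. by move=> Px Py; rewrite -[y]opprK; apply/(int_primeB Pprime)/int_primeN. Qed.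

Lemma int_prime_sum (I : Type) (r : seq I) (Q : pred I) (F : I -> algC) :
  (forall i, Q i -> P (F i)) -> P (\sum_(i <- r | Q i) F i).
Proof.
move=> FP; elim/big_ind: _ => //; first exact: int_prime0.
exact: int_primeD.
Qed.

(** With i and k the least indices of coefficients outside P, the coefficient of index i + k of the
    product is outside P. *)
Lemma int_prime_gauss (A B : {poly algC}) :
    A \is a polyOver Aint -> B \is a polyOver Aint ->
    (forall i, P (A * B)`_i) ->
  (forall i, P A`_i) \/ (forall i, P B`_i).
Proof.
move=> /polyOverP AA /polyOverP BA ABP; apply: contrapT => /not_orP[/existsNP nA /existsNP nB].
have exA : exists i, `[< ~ P A`_i >] by have [i] := nA; exists i; apply/asboolP.
have exB : exists i, `[< ~ P B`_i >] by have [i] := nB; exists i; apply/asboolP.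
case: (ex_minnP exA) => i /asboolP Ai iP; case: (ex_minnP exB) => k /asboolP Bk kP.
have iP' l : (l < i)%N -> P A`_l.
  by move=> li; apply: contrapT => /asboolP/iP; rewrite leqNgt li.
have kP' l : (l < k)%N -> P B`_l.
  by move=> lk; apply: contrapT => /asboolP/kP; rewrite leqNgt lk.
have ltik : (i < (i + k).+1)%N by rewrite ltnS leq_addr.
have : P (A`_i * B`_k).
  have := ABP (i + k)%N; rewrite coefM (bigD1 (Ordinal ltik)) //= addKn => H.
  rewrite -[_ * _](addrK (\sum_(l < (i + k).+1 | l != Ordinal ltik) A`_l * B`_(i + k - l))).
  apply: (int_primeB Pprime) => //; apply: int_prime_sum => l; rewrite -val_eqE /= neq_ltn.
  case/orP => [li|il]; first by rewrite mulrC; apply: int_primeM => //; apply: iP'.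
  apply: int_primeM => //; apply: kP'; rewrite ltn_subLR ?ltn_add2r //.
  by rewrite -ltnS.
by case/(int_primeP Pprime).
Qed.

Lemma int_prime_gauss_prod (I : eqType) (r : seq I) (F : I -> {poly algC}) :
    (forall i, i \in r -> F i \is a polyOver Aint) ->
    (forall k, P (\prod_(i <- r) F i)`_k) ->
  exists2 i, i \in r & forall k, P (F i)`_k.
Proof.
elim: r => [|i r IHr] FA; first by rewrite big_nil => /(_ 0%N); rewrite coef1 => /int_prime1.
rewrite big_cons => /int_prime_gauss[||iP|rP].
- by apply: FA; rewrite mem_head.
- by rewrite big_seq; apply: rpred_prod => k kr; apply: FA; rewrite inE kr orbT.
- by exists i; rewrite ?mem_head.
have [||k kr kP] := IHr => //; first by move=> k kr; apply: FA; rewrite inE kr orbT.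
by exists k; rewrite // inE kr orbT.
Qed.

(** Orbits of s are finite, so each x of P is the image under s of some s^k x, which lies in P. *)
Lemma decomposition_sub (s : absGal) : (forall x, P x -> P (s x)) -> decomposition P s.
Proof.
move=> sP; rewrite /decomposition /= eqEsubset; split=> [_ [x /sP Px <-]//|x Px].
have [k kx] := absGal_finite_orbit s x; exists ((s ^+ k)%g x); last first.
  by rewrite -absGalM -expgS kx.
elim: k {kx} => [|k IHk]; first by rewrite expg0.
by rewrite expgS absGalM; apply: sP.
Qed.

End IntPrime.

(** * Lifting decomposition groups from K to algC *)

Section NumberFieldLifts.

Variables (K : splittingFieldType rat) (kC : {rmorphism K -> algC}).

Lemma restriction_eq (s : absGal) (g : gal_of {:K}) :
  (forall x, s (kC x) = kC (g x)) -> restriction kC s = g.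
Proof.
move=> sg; apply/eqP/gal_eqP => x _; apply: (fmorph_inj kC).
by rewrite restrictionP sg.
Qed.

Lemma restriction1 : restriction kC 1%g = 1%g.
Proof. by apply: restriction_eq => x; rewrite gal_id. Qed.

Lemma restrictionX s n : restriction kC (s ^+ n)%g = (restriction kC s ^+ n)%g.
Proof.
elim: n => [|n IHn]; first by rewrite !expg0 restriction1.
by rewrite expgS restrictionM IHn expgSr.
Qed.

Lemma restriction_surj (g : gal_of {:K}) : exists s, restriction kC s = g.
Proof.
have [nu nuP] := extend_algC_subfield_aut kC g.
by exists (absGal_of nu); apply: restriction_eq => x; rewrite nuP.
Qed.

(** The Galois correspondence in the normal number field generated by the conjugates of a and of a
    primitive element of K, whose automorphisms all extend to algC. *)
Lemma num_field_fixed a :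
    (forall t, restriction kC t = 1%g -> t a = a) ->
  exists b, a = kC b.
Proof.
move=> fix_a; pose th := separable_generator 1 {:K}.
have sep (L : fieldExtType rat) (E : {subfield L}) : separable 1 E.
  apply/separableP => y _; apply/negPn/negP => /separablePn_pchar[l].
  by rewrite pchar_lalg pchar_num.
have Kth : {:K}%VS = <<1; th>>%VS.
  by apply: eq_adjoin_separable_generator; [apply: sep|apply: sub1v].
have [q1 [q1E q1_mon] _] := minCpolyP (kC th); have [q2 [q2E q2_mon] _] := minCpolyP a.
have [r rE] := closed_field_poly_normal (map_poly ratr (q1 * q2) : {poly algC}).
move: rE; rewrite lead_coef_map (monicP _) ?rmorph1 ?scale1r ?rpredM // => rE.
have [Qs [QsC [s1 s1E Qs_gen]]] := num_field_exists r.
have in_r x : root (map_poly ratr (q1 * q2)) x -> exists2 y, y \in s1 & x = QsC y.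
  by rewrite rE root_prod_XsubC -s1E => /mapP.
have [th' _ thE] : exists2 y, y \in s1 & kC th = QsC y.
  by apply: in_r; rewrite rmorphM /= rootM -q1E root_minCpoly.
have [a' _ aE] : exists2 y, y \in s1 & a = QsC y.
  by apply: in_r; rewrite rmorphM /= rootM -q2E root_minCpoly orbT.
have Qs_split : FieldExt_isSplittingField _ Qs.
  constructor; exists (map_poly (in_alg Qs) (q1 * q2)).
    by apply/polyOver1P; exists (q1 * q2).
  exists s1 => //; rewrite -(eqp_map QsC) -map_poly_comp.
  rewrite (eq_map_poly (g := ratr)) => [|c]; last by rewrite /= alg_num_field fmorph_rat.
  rewrite rE -s1E big_map rmorph_prod /=.
  rewrite [X in _ %= X](eq_bigr (fun y => 'X - (QsC y)%:P)) ?eqpxx // => y _.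
  exact: map_polyXsubC.
pose Q := HB.pack_for (splittingFieldType rat) Qs Qs_split.
have galQ : galois <<1; th' : Q>> {:Q}.
  by apply: (@galoisS _ _ 1%AS); rewrite ?sub1v ?subvf // /galois sub1v sep normalFieldf.
have ev (L : fieldExtType rat) (f : {rmorphism L -> algC}) (q : {poly rat}) x :
    f (map_poly (in_alg L) q).[x] = (map_poly ratr q).[f x].
  rewrite -horner_map -map_poly_comp; congr (_.[_]); apply: eq_map_poly => c.
  by rewrite /= alg_num_field fmorph_rat.
have : (a' : Q) \in fixedField 'Gal({:Q} / <<1; th' : Q>>)%g.
  apply/fixedFieldP => [|g gG]; first exact: memvf.
  have [nu nuP] := extend_algC_subfield_aut QsC g.
  apply: (fmorph_inj QsC); rewrite nuP -aE.
  apply: (fix_a (absGal_of nu)); apply: restriction_eq => x; rewrite gal_id /=.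
  have : x \in <<1; th>>%VS by rewrite -Kth memvf.
  case/Fadjoin_polyP => f /polyOver1P[f0 ->] ->.
  rewrite ev -horner_map -map_poly_comp (eq_map_poly (g := ratr)) => [|c].
    2: exact: fmorph_rat.
  congr (_.[_]); rewrite thE -nuP; congr (QsC _).
  by apply: (fixed_gal _ gG); rewrite ?subvf ?memv_adjoin.
rewrite (galois_fixedField galQ) => /Fadjoin_polyP[f /polyOver1P[f0 ->] a'E].
by exists (map_poly (in_alg K) f0).[th]; rewrite aE a'E (ev K) (ev Qs) thE.
Qed.

Section DecompositionLift.

Variables (P : set algC) (Pprime : int_prime P).

(** Take the polynomial with coefficient list r and the product N of its distinct conjugates over K.
    The coefficients of N lie in K and in P, so a lift s0 of g keeps them in P; by Gauss's lemma
    some factor s0 t (r) has all its coefficients in P. *)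
Lemma decomposition_lift_seq (g : gal_of {:K}) (r : seq algC) :
    g \in decomp_in kC P -> (forall x, x \in r -> P x) ->
  exists2 u, restriction kC u = g & forall x, x \in r -> P (u x).
Proof.
rewrite inE => /andP[_ /asboolP gP] rP; have [s0 s0g] := restriction_surj g.
have [L LP] := conjugate_seqs_finite r.
pose conj (w : seq algC) := exists2 t, restriction kC t = 1%g & w = map t r.
pose W := undup [seq w <- L | `[< conj w >]].
have W_P w : w \in W <-> conj w.
  rewrite mem_undup mem_filter; split=> [/andP[/asboolP]//|cw].
  by apply/andP; split; [exact/asboolP|case: cw => t _ ->].
have AP x : P x -> x \in Aint by apply: int_prime_sub.
have Poly_Aint w (u : absGal) : w \in W -> Poly (map u w) \is a polyOver Aint.
  move=> /W_P[t _ ->]; rewrite -map_comp; apply/polyOverP => i; rewrite coef_Poly.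
  have [ir|ri] := ltnP i (size r); last by rewrite nth_default ?size_map ?rpred0.
  by rewrite (nth_map 0) //= Aint_aut Aint_aut; apply/AP/rP/mem_nth.
pose N := \prod_(w <- W) Poly w.
have mapN (u : absGal) : map_poly u N = \prod_(w <- W) Poly (map u w).
  rewrite rmorph_prod /=; apply: eq_bigr => w _.
  exact: map_Poly.
(* Automorphisms over K permute [W], hence fix N. *)
have NK i : exists b : K, N`_i = kC b.
  apply: num_field_fixed => t t1; rewrite -coef_map.
  suff -> : map_poly t N = N by []; rewrite mapN.
  have mapt_inj : injective (map t) by apply: inj_map; apply: fmorph_inj.
  transitivity (\prod_(w <- map (map t) W) Poly w); first by rewrite big_map.
  apply: perm_big; apply: uniq_perm.
  - by rewrite map_inj_uniq ?undup_uniq.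
  - exact: undup_uniq.
  move=> w; apply/mapP/idP => [[w' /W_P[t' t'1 ->] ->]|/W_P[t' t'1 ->]].
    apply/W_P; exists (t * t')%g; first by rewrite restrictionM t1 t'1 mulg1.
    by rewrite -map_comp; apply: eq_map => x.
  exists (map (t^-1 * t')%g r); last first.
    by rewrite -map_comp; apply: eq_map => x; rewrite -[in LHS](mulKVg t t').
  apply/W_P; exists (t^-1 * t')%g => //; rewrite restrictionM t'1 mul1g.
  by apply: (mulgI (restriction kC t)); rewrite mulg1 -restrictionM mulVg restriction1.
have NP i : P N`_i.
  have rW : r \in W.
    by apply/W_P; exists 1%g; [exact: restriction1|rewrite (eq_map (g := id)) ?map_id].
  rewrite /N (big_rem r) //= coefM; apply: int_prime_sum => // l _; rewrite mulrC.
  apply: int_primeM => //.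
    have /polyOverP : \prod_(w <- rem r W) Poly w \is a polyOver Aint; last exact.
    rewrite big_seq; apply: rpred_prod => w /mem_rem wW.
    by have := Poly_Aint w 1%g wW; rewrite (eq_map (g := id)) ?map_id.
  rewrite coef_Poly; have [lr|rl] := ltnP l (size r); first exact/rP/mem_nth.
  by rewrite nth_default //; exact: int_prime0.
have s0NP i : P (map_poly s0 N)`_i.
  rewrite coef_map /=; have [b bE] := NK i.
  by rewrite bE -restrictionP s0g; apply/gP; rewrite /prime_in /= -bE.
have WA w : w \in W -> Poly (map s0 w) \is a polyOver Aint by move=> /Poly_Aint.
have Ws0 k : P (\prod_(w <- W) Poly (map s0 w))`_k by rewrite -mapN.
have [w /W_P[t t1 wE] wP] := int_prime_gauss_prod Pprime WA Ws0.
exists (s0 * t)%g; first by rewrite restrictionM t1 mul1g.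
move=> x xr; have := wP (index x r); rewrite coef_Poly wE -map_comp.
by rewrite (nth_map 0) ?index_mem // nth_index.
Qed.

(** A cluster point of the lifts found for finite lists, ordered by inclusion. *)
Lemma decomposition_lift (g : gal_of {:K}) : g \in decomp_in kC P ->
  exists2 s, decomposition P s & restriction kC s = g.
Proof.
move=> gD; have /choice[u uP] (r : seq algC) : exists u, restriction kC u = g /\
    forall x, x \in r -> P x -> P (u x).
  pose r' := [seq x <- r | `[< P x >]].
  have [|u ug uP] := @decomposition_lift_seq g r' gD.
    by move=> x; rewrite mem_filter => /andP[/asboolP].
  exists u; split=> // x xr Px; apply: uP; rewrite mem_filter xr andbT; exact/asboolP.
have [||t tP] := @absGal_cluster (seq algC) (fun r r' => {subset r <= r'}) [::] u.
- move=> r r'; exists (r ++ r'); split=> x xr; rewrite mem_cat xr ?orbT //.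
- by move=> r1 r2 r3 h1 h2 x /h1/h2.
exists t; last first.
  apply: restriction_eq => x; have [r _ /(_ (kC x))] := tP [::] [:: kC x].
  by rewrite mem_head => ->//; rewrite -restrictionP (uP r).1.
apply: decomposition_sub => x Px; have [r xr tr] := tP [:: x] [:: x].
by rewrite tr ?mem_head //; apply: (uP r).2 => //; apply: xr; rewrite mem_head.
Qed.

End DecompositionLift.

End NumberFieldLifts.

                                     

(** * Roots of order p^n of integers close to 1 *)

Section PowerLifting.

Variables (p : nat) (p_pr : prime p) (p_odd : odd p).

Lemma exprD_trunc3 (R : comNzRingType) (b x : R) n : exists q,
  (b + x) ^+ n.+3 = b ^+ n.+3 + n.+3%:R * b ^+ n.+2 * x
                    + 'C(n.+3, 2)%:R * b ^+ n.+1 * x ^+ 2 + x ^+ 3 * q.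
Proof.
pose q := \sum_(i < n.+1) b ^+ (n - i) * x ^+ i *+ 'C(n.+3, i.+3); exists q.
rewrite exprDn 3!big_ord_recl /= !addrA; congr (_ + _ + _ + _).
- by rewrite bin0 expr0 mulr1 mulr1n.
- by rewrite bin1 /bump /= expr1 subSS subn0 -mulr_natl mulrA.
- by rewrite /bump /= !subSS subn0 -mulr_natl mulrA.
rewrite mulr_sumr; apply: eq_bigr => i _.
have -> : bump 0 (bump 0 (bump 0 i)) = (3 + i)%N by rewrite /bump /= !add1n.
by rewrite !addSn add0n !subSS -[i.+3]/(3 + i)%N (exprD x 3) mulrCA mulrnAr.
Qed.

(** Newton correction. As b^(p-1) = 1 modulo p, the linear term cancels the error up to p^(j+i+2);
    the quadratic term gains a factor p from the binomial coefficient because p is odd, and the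
    cubic remainder is small enough since j > 0. *)
Lemma root_pth_step (j i : nat) (a b c d : int) : (0 < j)%N ->
    b = 1 + p%:R ^+ j * d -> b ^+ p = a + p%:R ^+ (j + i).+1 * c ->
  exists e, (b - p%:R ^+ (j + i) * c) ^+ p = a + p%:R ^+ (j + i).+2 * e.
Proof.
move=> j0 bE bp; have p2 : (2 < p)%N.
  by have := prime_gt1 p_pr; move: p_odd; case: p => [|[|[|]]].
have [n pn] : exists n, p = n.+3 by exists (p - 3)%N; rewrite -addn3 subnK.
have [q qE] := exprD_trunc3 b (- (p%:R ^+ (j + i) * c)) n.
rewrite -pn in qE; rewrite qE bp.
have [u uE] : exists u : int, b ^+ n.+2 = 1 + p%:R * u.
  have -> : b = 1 + p%:R * (p%:R ^+ j.-1 * d) by rewrite bE mulrA -exprS prednK.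
  elim: (n.+2) => [|m [u IHm]].
    by exists 0; rewrite mulr0 addr0 expr0.
  exists (p%:R ^+ j.-1 * d + u + p%:R ^+ j.-1 * d * p%:R * u); rewrite exprS IHm; ring.
have /dvdnP[v vE] : (p %| 'C(p, 2))%N by rewrite prime_dvd_bin.
rewrite vE natrM uE.
have [l lE] : exists l, (j + i)%N = l.+1 by exists (j + i).-1; rewrite prednK // ltn_addr.
rewrite lE.
exists (- u * c + v%:R * b ^+ n.+1 * p%:R ^+ l * c ^+ 2
        - p%:R ^+ l * p%:R ^+ l * c ^+ 3 * q).
rewrite (exprS p%:R l.+2) !(exprS p%:R l.+1) !(exprS p%:R l).
move: (b ^+ n.+1) (p%:R : int) (v%:R : int) => B P V; move: (P ^+ l) => z.
ring.
Qed.

Lemma root_pth (j i : nat) (a : int) : (0 < j)%N -> (exists c, a = 1 + p%:R ^+ j.+1 * c) ->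
  exists b c d, b = 1 + p%:R ^+ j * d /\ b ^+ p = a + p%:R ^+ (j + i).+1 * c.
Proof.
move=> j0 [c0 aE]; elim: i => [|i [b [c [d [bE bp]]]]].
  by exists 1, (- c0), 0; rewrite mulr0 addr0 expr1n addn0 aE; split=> //; ring.
have [e eE] := root_pth_step j0 bE bp.
exists (b - p%:R ^+ (j + i) * c), e, (d - p%:R ^+ i * c); split; last by rewrite addnS.
by rewrite bE exprD; ring.
Qed.

Lemma root_pXth n j k (a : int) : (0 < j)%N -> (exists c, a = 1 + p%:R ^+ (n + j) * c) ->
  exists b c d, b = 1 + p%:R ^+ j * d /\ b ^+ (p ^ n) = a + p%:R ^+ k * c.
Proof.
elim: n j a => [|n IHn] j a j0 aE.
  by have [c cE] := aE; exists a, 0, c; rewrite expr1 mulr0 addr0.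
have [|b1 [c1 [d1 [b1E b1p]]]] := IHn j.+1 a isT; first by rewrite addnS -addSn.
have [|b [c [d [bE bp]]]] := @root_pth j k b1 j0; first by exists d1.
have [u uE] : exists u, b ^+ p = b1 + p%:R ^+ k * u.
  by exists (p%:R ^+ j.+1 * c); rewrite bp -addSn exprD; ring.
exists b; have [v vE] : exists v, b ^+ (p ^ n.+1) = b1 ^+ (p ^ n) + p%:R ^+ k * v.
  rewrite expnS exprM uE; elim: (p ^ n)%N => [|m [v IHm]].
    by exists 0; rewrite mulr0 addr0.
  exists (b1 * v + u * b1 ^+ m + u * p%:R ^+ k * v); rewrite exprS IHm exprS; ring.
by exists (c1 + v), d; split=> //; rewrite vE b1p; ring.
Qed.

(** Elements of 1 + p^(n+1) Z_p are p^n-th powers: n successive p-th roots, each losing one power of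
    p in the congruence to 1. *)
Lemma nat_root_pXth n k (a : nat) : a = 1 %[mod p ^ n.+1] ->
  exists2 b, coprime b p & b ^ (p ^ n) = a %[mod p ^ k].
Proof.
move=> a1; have p1 := prime_gt1 p_pr.
have [|b [c [d [bE bp]]]] := @root_pXth n 1 k.+1 a%:Z isT.
  exists (a %/ p ^ n.+1)%N%:Z; rewrite {1}(divn_eq a (p ^ n.+1)) a1 modn_small.
    by rewrite PoszD PoszM addn1 -natrX addrC mulrC pmulrn intz.
  by rewrite -{1}(expn0 p) ltn_exp2l.
(* Reducing modulo p^(k+1) rather than p^k keeps b0 prime to p even when k = 0. *)
pose b0 := `|(b %% (p ^ k.+1)%N)%Z|%N.
have pk0 : (p ^ k.+1)%N%:Z != 0 by rewrite eqz_nat -lt0n expn_gt0 ltnW.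
have pXE m : p%:R ^+ m = (p ^ m)%N%:Z by rewrite -natrX pmulrn intz.
have [u b0E] : exists u, b0%:Z = b + p%:R ^+ k.+1 * u.
  exists (- (b %/ (p ^ k.+1)%N)%Z); rewrite gez0_abs ?modz_ge0 // pXE /modz.
  by rewrite mulrN mulrC.
exists b0.
  rewrite coprime_sym prime_coprime //; apply/negP => /dvdnP[v b0v].
  have pv : p%:R * v%:Z = 1 + p%:R * d + p%:R * (p%:R ^+ k * u).
    by rewrite -[p%:R * d]/(p%:R ^+ 1 * d) -bE mulrA -exprS -b0E b0v PoszM mulrC pmulrn intz.
  have : 1 = p%:R * (v%:Z - p%:R ^+ k * u - d) by rewrite !mulrBr pv; ring.
  move/(congr1 absz); rewrite abszM pmulrn intz /= => /esym/eqP.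
  by rewrite muln_eq1 => /andP[/eqP p1' _]; rewrite p1' in p1.
have [v vE] : exists v, b0%:Z ^+ (p ^ n) = b ^+ (p ^ n) + p%:R ^+ k.+1 * v.
  rewrite b0E; elim: (p ^ n)%N => [|m [v IHm]].
    by exists 0; rewrite mulr0 addr0.
  exists (b * v + u * b ^+ m + u * p%:R ^+ k.+1 * v); rewrite exprS IHm [b ^+ m.+1]exprS.
  by move: (b ^+ m) (p%:R ^+ k.+1 : int) => B P; ring.
apply/eqP; rewrite -eqz_nat -!modz_nat -natz natrX natz eqz_mod_dvd vE bp.
have -> : a%:Z + p%:R ^+ k.+1 * c + p%:R ^+ k.+1 * v - a%:Z = p%:R ^+ k * (p%:R * (c + v)).
  by rewrite exprS; ring.
by rewrite pXE dvdz_mulr.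
Qed.

End PowerLifting.

(** * Galois action on p-power roots of unity and the cyclotomic tower *)

Lemma absGalB (s : absGal) x y : s (x - y) = s x - s y.
Proof. exact: rmorphB. Qed.
Lemma absGal_div (s : absGal) x y : s (x / y) = s x / s y.
Proof. exact: fmorph_div. Qed.
Lemma absGalX (s : absGal) x n : s (x ^+ n) = s x ^+ n.
Proof. exact: rmorphXn. Qed.
Lemma absGal_id x : (1%g : absGal) x = x. Proof. by []. Qed.
Lemma absGalK (s : absGal) x : s^-1%g (s x) = x.
Proof. by rewrite -absGalM mulVg. Qed.
Lemma absGalVK (s : absGal) x : s (s^-1%g x) = x.
Proof. by rewrite -absGalM mulgV. Qed.
Lemma absGal_unit (s : absGal) : s 1 = 1. Proof. exact: rmorph1. Qed.
Lemma absGal_inj (s : absGal) : injective s. Proof. exact: fmorph_inj. Qed.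

(** Here a is the value at s of the cyclotomic character modulo n. *)
Lemma absGal_root_unity (s : absGal) n : (0 < n)%N ->
  exists2 a, coprime a n & forall z, z ^+ n = 1 -> s z = z ^+ a.
Proof.
move=> n0; have [z0 z0n] := C_prim_root_exists n0.
have /(prim_rootP z0n)[a sa] : s z0 ^+ n = 1 by rewrite -rmorphXn prim_expr_order ?rmorph1.
exists a; first by rewrite -(prim_root_exp_coprime _ z0n) -sa fmorph_primitive_root.
by move=> _ /(prim_rootP z0n)[i ->]; rewrite rmorphXn /= sa exprAC.
Qed.

Lemma absGalX_root_unity (s : absGal) n a k :
    (forall z, z ^+ n = 1 -> s z = z ^+ a) ->
  forall z, z ^+ n = 1 -> (s ^+ k)%g z = z ^+ (a ^ k).
Proof.
move=> sa z zn; elim: k => [|k IHk]; first by rewrite expg0 expr1.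
by rewrite expgS absGalM IHk rmorphXn /= sa // -exprM expnS.
Qed.

Lemma gen_subfield_subfield X : subfield (gen_subfield X).
Proof.
split=> [L [[L1 _ _] _]//|x y Xx Xy L LX|x y Xx Xy L LX]; have [[_ LB LV] _] := LX.
  by apply: LB; [apply: Xx|apply: Xy].
by apply: LV; [apply: Xx|apply: Xy].
Qed.

Lemma sub_gen_subfield X : X `<=` gen_subfield X.
Proof. by move=> x Xx L [_]; apply. Qed.

Lemma gen_subfield_min X L : subfield L -> X `<=` L -> gen_subfield X `<=` L.
Proof. by move=> Ls XL x; apply. Qed.

Lemma gen_subfield_agree X (s t : absGal) :
  (forall x, X x -> s x = t x) -> agree_on (gen_subfield X) s t.
Proof.
move=> st; apply: (@gen_subfield_min X [set x | s x = t x]) => //.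
split=> [|x y /= sx sy|x y /= sx sy].
- by rewrite /= !rmorph1.
- by rewrite !absGalB sx sy.
by rewrite !absGal_div sx sy.
Qed.

Lemma gen_subfield_stable X (s : absGal) :
  (forall x, X x -> X (s x)) -> forall x, gen_subfield X x -> gen_subfield X (s x).
Proof.
move=> sX; have [X1 XB XV] := gen_subfield_subfield X.
apply: (@gen_subfield_min X [set x | gen_subfield X (s x)]) => [|x /sX].
  2: exact: sub_gen_subfield.
split=> [|x y /= Xx Xy|x y /= Xx Xy].
- by rewrite /= rmorph1.
- by rewrite rmorphB; apply: XB.
by rewrite fmorph_div; apply: XV.
Qed.

Section Subfield.
Variables (L : set algC) (Ls : subfield L).

Lemma subfield1 : L 1. Proof. by case: Ls. Qed.
Lemma subfieldB x y : L x -> L y -> L (x - y).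
Proof. by case: Ls => _ + _; apply. Qed.
Lemma subfield0 : L 0. Proof. rewrite -(subrr 1); apply: subfieldB; exact: subfield1. Qed.
Lemma subfieldM x y : L x -> L y -> L (x * y).
Proof.
case: Ls => L1 _ LV Lx Ly; rewrite -[y]invrK; apply: (LV) => //.
by rewrite -[y^-1]mul1r; apply: LV.
Qed.

Lemma subfield_prod_XsubC (r : seq algC) :
  (forall x, x \in r -> L x) -> forall i, L (\prod_(x <- r) ('X - x%:P))`_i.
Proof.
elim: r => [|x r IHr] rL i.
  by rewrite big_nil coef1; case: eqP; [have := subfield1|have := subfield0].
have rL' k : L (\prod_(x <- r) ('X - x%:P))`_k.
  by apply: IHr => y yr; apply: rL; rewrite inE yr orbT.
rewrite big_cons mulrBl coefB coefXM coefCM; apply: subfieldB; last first.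
  by apply: subfieldM => //; apply: rL; rewrite mem_head.
by case: eqP => // _; exact: subfield0.
Qed.

End Subfield.

Lemma Gal_over_conj (L : set algC) (g s : absGal) :
    (forall x, L x -> L (g x)) -> Gal_over L s -> Gal_over L (g^-1 * s * g)%g.
Proof.
move=> gL sL x Lx; rewrite absGalM absGalM (sL (g x)); last exact: gL.
by rewrite !absGal_id absGalK.
Qed.

Lemma Gal_overM (L : set algC) s t : Gal_over L s -> Gal_over L t -> Gal_over L (s * t)%g.
Proof. by move=> sL tL x Lx; rewrite absGalM tL // sL. Qed.

Lemma Gal_overV (L : set algC) s : Gal_over L s -> Gal_over L s^-1%g.
Proof. by move=> sL x Lx; apply: (@absGal_inj s); rewrite absGalVK sL. Qed.

Lemma Gal_over1 (L : set algC) : Gal_over L 1%g. Proof. by []. Qed.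

Section CyclotomicTower.

Variables (p : nat) (p_pr : prime p) (p_odd : odd p).
Local Notation mu := (Q_mu_pinf p).
Local Notation Qoo := (Q_infty p).

Let pX0 k : (0 < p ^ k)%N. Proof. by rewrite expn_gt0 prime_gt0. Qed.

Lemma mu_stable (s : absGal) x : mu x -> mu (s x).
Proof.
by apply: gen_subfield_stable => {}x [n xn]; exists n; rewrite -rmorphXn xn rmorph1.
Qed.

Lemma mu_abelian (s t : absGal) x : mu x -> s (t x) = t (s x).
Proof.
move: x; suff : agree_on mu (s * t)%g (t * s)%g by [].
apply: gen_subfield_agree => z [n zn]; rewrite !absGalM.
have [a _ sa] := absGal_root_unity s (pX0 n); have [b _ tb] := absGal_root_unity t (pX0 n).
by rewrite [t z]tb // [s z]sa // !rmorphXn /= sa // tb // exprAC.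
Qed.

Lemma mu_expgM (s t : absGal) n x :
  mu x -> ((s * t) ^+ n)%g x = (s ^+ n)%g ((t ^+ n)%g x).
Proof.
elim: n x => [|n IHn] x mx //; rewrite expgS absGalM IHn // absGalM.
rewrite -(mu_abelian (s ^+ n)%g t); last exact: mu_stable.
by rewrite -!absGalM !expgS !mulgA.
Qed.

(** Each x lies in some Q(mu_{p^k}); this is phrased through automorphisms to avoid describing that
    field. *)
Lemma mu_finite_level x : mu x -> exists k, forall s t : absGal,
  (forall z, z ^+ (p ^ k) = 1 -> s z = t z) -> s x = t x.
Proof.
move: x; apply: gen_subfield_min => [|z [k zk]]; last by exists k => s t; apply.
have up k m (s t : absGal) : (k <= m)%N -> (forall z, z ^+ (p ^ m) = 1 -> s z = t z) ->
    forall z, z ^+ (p ^ k) = 1 -> s z = t z.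
  by move=> km st z zk; apply: st; rewrite -(subnKC km) expnD exprM zk expr1n.
split=> [|x y [k kx] [m my]|x y [k kx] [m my]]; first by exists 0%N => s t _; rewrite !rmorph1.
  exists (maxn k m) => s t st; rewrite !absGalB (kx s t) ?(my s t) //; apply: up st.
    exact: leq_maxr.
  exact: leq_maxl.
exists (maxn k m) => s t st; rewrite !absGal_div (kx s t) ?(my s t) //; apply: up st.
  exact: leq_maxr.
exact: leq_maxl.
Qed.

Lemma expg_conj (s t : absGal) n : ((s^-1 * t * s) ^+ n = s^-1 * t ^+ n * s)%g.
Proof.
elim: n => [|n IHn]; first by rewrite !expg0 mulg1 mulVg.
by rewrite !expgS IHn !mulgA mulgK.
Qed.

Lemma Q_infty_stable (s : absGal) x : Qoo x -> Qoo (s x).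
Proof.
move=> [mx fx]; split=> [|t [m m0 tm]]; first exact: mu_stable.
apply: (@absGal_inj s^-1%g); rewrite absGalK -!absGalM.
apply: fx; exists m => //; rewrite expg_conj; apply: Gal_over_conj => // y.
exact: mu_stable.
Qed.

Lemma Gamma_conj n (s t : absGal) : Gamma_ p n t -> Gamma_ p n (s^-1 * t * s)%g.
Proof.
move=> [u tu]; exists (s^-1 * u * s)%g => x Qx; rewrite expg_conj !absGalM.
by rewrite (tu (s x)) //; apply: Q_infty_stable.
Qed.

Lemma Q_stable n (s : absGal) x : Q_ p n x -> Q_ p n (s x).
Proof.
move=> [Qx fx]; split=> [|t Gt]; first exact: Q_infty_stable.
apply: (@absGal_inj s^-1%g); rewrite absGalK -!absGalM.
by apply: fx; apply: Gamma_conj.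
Qed.

Lemma Gal_Q_conj n (g s : absGal) :
  Gal_over (Q_ p n) s -> Gal_over (Q_ p n) (g^-1 * s * g)%g.
Proof. by apply: Gal_over_conj; apply: Q_stable. Qed.

Lemma Gal_mu_sub_infty : Gal_over mu `<=` Gal_over Qoo.
Proof. by move=> s sL x [mx _]; apply: sL. Qed.

Lemma Gal_infty_sub n : Gal_over Qoo `<=` Gal_over (Q_ p n).
Proof. by move=> s sL x [mx _]; apply: sL. Qed.

Lemma Gal_Q_decr n m : (n <= m)%N -> Gal_over (Q_ p m) `<=` Gal_over (Q_ p n).
Proof. by move=> nm s sL x /(Q_incr nm); apply: sL. Qed.

Lemma Gamma_sub n : Gamma_ p n `<=` Gal_over (Q_ p n).
Proof. by move=> s Gs x [_ fx]; apply: fx. Qed.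

Lemma commutator_mu (s t : absGal) : Gal_over mu (s * t * s^-1 * t^-1)%g.
Proof.
move=> x mx; rewrite !absGalM (mu_abelian t); last exact: mu_stable.
by rewrite absGalVK absGalVK.
Qed.

(** The cyclotomic character of s is 1 modulo p^(m+1), so at any finite level it is a p^m-th power
    b^(p^m). The automorphism with character b then has its p^m-th power in Gamma_m, which fixes x
    and acts on x as s does. *)
Lemma fix_roots_Gal_Q m (s : absGal) :
  (forall z, z ^+ (p ^ m.+1) = 1 -> s z = z) -> Gal_over (Q_ p m) s.
Proof.
move=> sz x [Qx fx]; have [k kx] := mu_finite_level Qx.1.
have [a _ sa] := absGal_root_unity s (pX0 (maxn k m.+1)).
have [zeta zetaP] := C_prim_root_exists (pX0 m.+1).
have a1 : a = 1 %[mod p ^ m.+1].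
  have zM : zeta ^+ (p ^ maxn k m.+1) = 1.
    by rewrite -(subnKC (leq_maxr k m.+1)) expnD exprM (prim_expr_order zetaP) expr1n.
  by apply/eqP; rewrite -(eq_prim_root_expr zetaP) expr1 -(sa _ zM) sz ?prim_expr_order.
have [b bp ba] := nat_root_pXth p_pr p_odd (maxn k m.+1) a1.
have [u uP] := @Qn_aut_exists b (p ^ maxn k m.+1) (coprimeXr _ bp).
have uP' : forall z, z ^+ (p ^ maxn k m.+1) = 1 -> absGal_of u z = z ^+ b by [].
rewrite -[RHS](fx (absGal_of u ^+ (p ^ m))%g); last by exists (absGal_of u) => y.
apply: kx => z zk.
have zM : z ^+ (p ^ maxn k m.+1) = 1.
  by rewrite -(subnKC (leq_maxl k m.+1)) expnD exprM zk expr1n.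
rewrite sa // (absGalX_root_unity _ uP') //.
by rewrite -(expr_mod a zM) -ba expr_mod.
Qed.

                                                                              
                                                                                    
(** A limit of s^(p^(k phi(N))), with phi the Euler function. These exponents are 1 modulo N, so t
    looks like s on groups of order N; by Euler's theorem t has order dividing p - 1 on [mu], hence
    is trivial on Q_infty. *)
Lemma prime_to_p_part (s : absGal) N : ~~ (p %| N)%N -> exists t : absGal,
  [/\ Gal_over mu (t ^+ p.-1)%g, Gal_over Qoo t &
      forall r : seq algC, exists q, p ^ q = 1 %[mod N] /\ {in r, t =1 (s ^+ (p ^ q))%g}].
Proof.
move=> pN; have N0 : (0 < N)%N by case: posnP pN => // ->; rewrite dvdn0.
have tN : (0 < totient N)%N by rewrite totient_gt0.
have [||t tP] := @absGal_cluster nat leq 0%N (fun k => s ^+ (p ^ (k * totient N)))%g.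
- by move=> i k; exists (maxn i k); rewrite leq_maxl leq_maxr.
- by move=> i k m; apply: leq_trans.
have tmu : Gal_over mu (t ^+ p.-1)%g.
  apply: gen_subfield_agree => z [n zn].
  have [a a_co sa] := absGal_root_unity s (pX0 n).
  have [k nk tz] := tP n [:: z]; have {}tz := tz z (mem_head _ _).
  have [b b_co tb] := absGal_root_unity t (pX0 n).
  have zb : z ^+ b = z ^+ (a ^ (p ^ (k * totient N))).
    by rewrite -tb // tz (absGalX_root_unity _ sa).
  rewrite (absGalX_root_unity _ tb) //.
  have -> : forall c, z ^+ (b ^ c) = z ^+ (a ^ (p ^ (k * totient N) * c)).
    elim=> [|c IHc]; first by rewrite muln0.
    by rewrite expnS mulnC exprM IHc -exprM mulnC exprM zb -exprM -expnD mulnS.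
  have [n0|n0] := posnP n; first by move: zn; rewrite n0 expr1 => ->; rewrite expr1n.
  (* The index k was taken at least n, so the exponent k phi(N) exceeds n - 1. *)
  have : (totient (p ^ n) %| p ^ (k * totient N) * p.-1)%N.
    rewrite totient_pfactor // mulnC dvdn_mul // dvdn_exp2l //.
    by rewrite (leq_trans (leq_pred _)) // (leq_trans nk) // leq_pmulr.
  case/dvdnP=> c ->; rewrite mulnC expnM.
  by rewrite -(expr_mod _ zn) -modnXm Euler_exp_totient // modnXm exp1n expr_mod // expr1.
exists t; split=> // [x [_ fx]|r].
  by apply: fx; exists p.-1 => //; rewrite -subn1 subn_gt0 prime_gt1.
have [k _ tr] := tP 0%N r; exists (k * totient N)%N; split=> //.
rewrite mulnC expnM -modnXm Euler_exp_totient ?modnXm ?exp1n //.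
by rewrite prime_coprime.
Qed.

(** The torsion conjugates of a primitive p^(n+1)-th root zeta are the roots of a polynomial F over
    Q_n. Hence g zeta = s zeta with s torsion, and s^-1 g fixes mu_{p^(n+1)}; at a high finite level
    it is therefore a p^n-th power t^(p^n), and u = s t^(p^n) works since s is trivial on
    Q_infty. *)
Lemma Gal_Q_decompose n m (g : absGal) : Gal_over (Q_ p n) g ->
  exists u v, [/\ Gamma_ p n u, Gal_over (Q_ p m) v & g = (u * v)%g].
Proof.
move=> gn; have [zeta zetaP] := C_prim_root_exists (pX0 n.+1).
have [X XP] := conjugates_finite zeta.
pose Tors : set absGal := [set s | exists2 k, (0 < k)%N & Gal_over mu (s ^+ k)%g].
have TorsM s t : Tors s -> Tors t -> Tors (s * t)%g.
  move=> [a a0 sa] [b b0 tb]; exists (a * b)%N; first by rewrite muln_gt0 a0.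
  have tE : (t ^+ (a * b) = (t ^+ b) ^+ a)%g by rewrite mulnC expgM.
  move=> x mx; rewrite mu_expgM // tE expgM.
  have fixX (u : absGal) k y : Gal_over mu u -> mu y -> (u ^+ k)%g y = y.
    by move=> uL my; elim: k => // k IHk; rewrite expgS absGalM IHk uL.
  by rewrite (fixX (t ^+ b)%g) // (fixX (s ^+ a)%g).
have Tors_fix s x : Tors s -> Qoo x -> s x = x by move=> Ts [_]; apply.
pose R := undup [seq z <- X | `[< exists2 s, Tors s & z = s zeta >]].
have RP z : z \in R <-> exists2 s, Tors s & z = s zeta.
  rewrite mem_undup mem_filter; split=> [/andP[/asboolP]//|Tz].
  by apply/andP; split; [exact/asboolP|case: Tz => s _ ->].
pose F := \prod_(z <- R) ('X - z%:P).
have F_fix (s : absGal) : (forall z, z \in R -> s z \in R) -> map_poly s F = F.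
  move=> sR; rewrite rmorph_prod /=.
  transitivity (\prod_(z <- map s R) ('X - z%:P)).
    by rewrite big_map; apply: eq_bigr => z _; rewrite map_polyXsubC.
  have sR_uniq : uniq (map s R) by rewrite map_inj_uniq ?undup_uniq //; apply: absGal_inj.
  have [_ sRE] : (size R <= size (map s R))%N /\ {subset map s R <= R}.
    by rewrite size_map leqnn; split=> // _ /mapP[z /sR + ->].
  have [] := uniq_min_size sR_uniq sRE; first by rewrite size_map.
  by move=> _ sRe; apply: perm_big; apply: uniq_perm; rewrite ?undup_uniq.
have zeta_mu : mu zeta by apply: sub_gen_subfield; exists n.+1; rewrite prim_expr_order.
have F_Qoo i : Qoo F`_i.
  split; last first.
    move=> s Ts; rewrite -[LHS]coef_map F_fix // => _ /RP[t Tt ->].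
    by apply/RP; exists (s * t)%g => //; apply: TorsM.
  apply: subfield_prod_XsubC; first exact: gen_subfield_subfield.
  by move=> _ /RP[s _ ->]; apply: mu_stable.
have F_Qn i : Q_ p n F`_i.
  split=> // u [t ut]; rewrite ut // -[LHS]coef_map F_fix // => _ /RP[s Ts ->].
  (* On mu_{p^(n+1)}, the automorphism t^(p^n) equals its own torsion part e, so it permutes [R]:
     p^q is 1 modulo p - 1, and a^(p^n (p-1)) is 1 modulo p^(n+1). *)
  have [|e [emu _ et]] := @prime_to_p_part (t ^+ (p ^ n))%g p.-1.
    apply/negP => /dvdn_leq; rewrite -subn1 subn_gt0 prime_gt1 // => /(_ isT).
    by rewrite leqNgt subn1 ltn_predL prime_gt0.
  have eT : Tors e by exists p.-1 => //; rewrite -subn1 subn_gt0 prime_gt1.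
  apply/RP; exists (e * s)%g; first exact: TorsM.
  have [q [q1 eq]] := et [:: s zeta]; rewrite absGalM eq ?mem_head // -expgM -expnD.
  have [a a_co ta] := absGal_root_unity t (pX0 n.+1).
  have szp : s zeta ^+ (p ^ n.+1) = 1 by rewrite -absGalX prim_expr_order ?absGal_unit.
  rewrite !(absGalX_root_unity _ ta) // -!(expr_mod (a ^ _) szp); congr (_ ^+ _).
  have : p ^ q = 1 %[mod p.-1] by [].
  have pq0 : (0 < p ^ q)%N by [].
  move/eqP; rewrite eqn_mod_dvd // => /dvdnP[c pq].
  rewrite expnD -(subnK pq0) pq mulnDr muln1 expnD mulnCA -modnMml expnM.
  have := Euler_exp_totient (coprimeXl c a_co); rewrite totient_pfactor //= mulnC => ->.
  by rewrite modnMml mul1n.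
have : root F (g zeta).
  have -> : F = map_poly g F.
    apply/polyP => i; rewrite coef_map /= (gn _ (F_Qn i)); exact: esym.
  rewrite fmorph_root root_prod_XsubC; apply/RP; exists 1%g => //.
  by exists 1%N => // x _; rewrite expg1.
rewrite root_prod_XsubC => /RP[s Ts gz].
have sg_fix z : z ^+ (p ^ n.+1) = 1 -> (s^-1 * g)%g z = z.
  by move=> /(prim_rootP zetaP)[i ->]; rewrite absGalX absGalM gz absGalK.
have [a _ ga] := absGal_root_unity (s^-1 * g)%g (pX0 (maxn n m).+1).
have zM z k : (k <= (maxn n m).+1)%N -> z ^+ (p ^ k) = 1 ->
    z ^+ (p ^ (maxn n m).+1) = 1 :> algC.
  by move=> kM zk; rewrite -(subnKC kM) expnD exprM zk expr1n.
have a1 : a = 1 %[mod p ^ n.+1].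
  have zetaM : zeta ^+ (p ^ (maxn n m).+1) = 1.
    by apply: (@zM _ n.+1); rewrite ?ltnS ?leq_maxl // (prim_expr_order zetaP).
  by apply/eqP; rewrite -(eq_prim_root_expr zetaP) expr1 -(ga _ zetaM) sg_fix ?prim_expr_order.
have [b bp ba] := nat_root_pXth p_pr p_odd (maxn n m).+1 a1.
have [u uP] := @Qn_aut_exists b (p ^ (maxn n m).+1) (coprimeXr _ bp).
pose t := absGal_of u.
have tP : forall z, z ^+ (p ^ (maxn n m).+1) = 1 -> t z = z ^+ b by [].
exists (s * t ^+ (p ^ n))%g, ((t ^+ (p ^ n))^-1 * (s^-1 * g))%g; split.
- exists t => x Qx; rewrite absGalM (Tors_fix s) //; exact: Q_infty_stable.
- apply: fix_roots_Gal_Q => z zm.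
  have {}zm : z ^+ (p ^ (maxn n m).+1) = 1 by apply: zM zm; rewrite ltnS leq_maxr.
  apply: (@absGal_inj (t ^+ (p ^ n))%g); rewrite absGalM absGalVK ga //.
  by rewrite (absGalX_root_unity _ tP) // -(expr_mod a zm) -ba expr_mod.
- by rewrite !mulgA mulgK mulgV mul1g.
Qed.

(** Roots of unity of p-power order are distinct modulo P. If xi = s z / z is not 1 but is 1 modulo
    P, its first p^n powers sum to 0 and are all 1 modulo P; so p^n lies in P along with l, which is
    absurd. *)
Lemma inertia_mu l (P : set algC) : Defs.prime_above l P -> prime l -> l != p ->
  Defs.inertia P `<=` Gal_over mu.
Proof.
move=> [Pp Pl] l_pr lp s [_ sI]; apply: gen_subfield_agree => z [n zn].
have z_int : z \in Aint by apply: (@Aint_unity_root (p ^ n)) => //; apply/unity_rootP.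
have z0 : z != 0.
  by apply: contra_eq_neq zn => ->; rewrite expr0n (gtn_eqF (pX0 n)) eq_sym oner_eq0.
apply: contrapT; rewrite absGal_id => /eqP szz; apply: (int_prime1 Pp).
have zV_int : z^-1 \in Aint.
  by rewrite -[z^-1]mul1r -zn -(prednK (pX0 n)) exprSr mulfK //; apply: rpredX.
pose xi := s z / z.
have xi_int : xi \in Aint by apply: rpredM => //; rewrite Aint_aut.
have xiP : P (xi - 1).
  have -> : xi - 1 = z^-1 * (s z - z) by rewrite mulrBr mulVf // mulrC.
  by apply: int_primeM => //; apply: sI.
have xiXP i : P (xi ^+ i - 1).
  rewrite subrX1 mulrC; apply: int_primeM => //.
  by apply: rpred_sum => k _; apply: rpredX.
have sum0 : \sum_(i < p ^ n) xi ^+ i = 0.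
  apply/eqP; have : (xi - 1) * \sum_(i < p ^ n) xi ^+ i = 0.
    by rewrite -subrX1 expr_div_n -absGalX zn absGal_unit divr1 subrr.
  move/eqP; rewrite mulf_eq0 subr_eq0 => /orP[/eqP xi1|//].
  by case/eqP: szz; rewrite -[s z](divfK z0) -/xi xi1 mul1r.
have Ppn : P (p ^ n)%:R.
  have -> : (p ^ n)%:R = - \sum_(i < p ^ n) (xi ^+ i - 1).
    by rewrite sumrB sum0 sub0r opprK sumr_const card_ord.
  by apply: int_primeN => //; apply: int_prime_sum.
have : coprime l (p ^ n) by rewrite coprimeXr // prime_coprime // dvdn_prime2.
case: (egcdnP (p ^ n) (prime_gt0 l_pr)) => a b abE _ /eqP lpn; rewrite lpn in abE.
have -> : 1 = a%:R * l%:R - b%:R * (p ^ n)%:R :> algC.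
  by rewrite -!natrM abE natrD addrC addKr.
by apply: (int_primeB Pp); apply: int_primeM => //; apply: Aint_Cnat; apply: rpred_nat.
Qed.

Lemma mu_sub_Q_Sigma (S : seq nat) : p \in S -> mu `<=` Q_Sigma S.
Proof.
move=> pS x mx; exists mu => //; split; first exact: gen_subfield_subfield.
move=> l l_pr lS P Pl; apply: (inertia_mu Pl) => //.
by apply: contraNneq lS => ->.
Qed.

End CyclotomicTower.

                                   

(** * Decomposition and inertia groups *)

Section IntPrimeGalois.

Variables (P : set algC) (Pprime : int_prime P).

Lemma decompositionP (s : absGal) x : decomposition P s -> P (s x) <-> P x.
Proof.
move=> sP; split=> [|Px]; last by rewrite -sP; exists x.
by rewrite -[in X in X -> _]sP => -[y Py /absGal_inj <-].
Qed.

Lemma decompositionM s t :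
  decomposition P s -> decomposition P t -> decomposition P (s * t)%g.
Proof.
move=> sP tP; apply: decomposition_sub => x Px; rewrite absGalM.
by apply/decompositionP => //; apply/decompositionP.
Qed.

Lemma decompositionV s : decomposition P s -> decomposition P s^-1%g.
Proof.
move=> sP; apply: decomposition_sub => x Px.
by apply/(decompositionP _ sP); rewrite absGalVK.
Qed.

Lemma inertiaM s t : Defs.inertia P s -> Defs.inertia P t -> Defs.inertia P (s * t)%g.
Proof.
move=> [sP sI] [tP tI]; split=> [|x xA]; first exact: decompositionM.
rewrite absGalM -(subrK (s x) (s (t x))) -absGalB -addrA.
by apply: int_primeD => //; [apply/decompositionP => //; apply: tI|apply: sI].
Qed.

Lemma inertiaV s : Defs.inertia P s -> Defs.inertia P s^-1%g.
Proof.
move=> [sP sI]; split=> [|x xA]; first exact: decompositionV.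
apply/(decompositionP _ sP); rewrite absGalB absGalVK -opprB.
by apply: int_primeN => //; apply: sI.
Qed.

Lemma inertia_conj s t : decomposition P s -> Defs.inertia P t ->
  Defs.inertia P (s * t * s^-1)%g.
Proof.
move=> sP [tP tI]; split=> [|x xA].
  by apply: decompositionM; [apply: decompositionM|apply: decompositionV].
rewrite !absGalM -{2}(absGalVK s x) -absGalB.
by apply/decompositionP => //; apply: tI; rewrite Aint_aut.
Qed.

End IntPrimeGalois.

(** * Descent of coboundaries *)

Section Cocycles.

Variables (M : zmodType) (act : absGal -> M -> M).

Definition is_cocycle (H : set absGal) (c : absGal -> M) :=
  forall s t, H s -> H t -> c (s * t)%g = c s + act s (c t).

Lemma coboundary_sub (H H' : set absGal) c :
  H' `<=` H -> coboundary act H c -> coboundary act H' c.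
Proof. by move=> H'H [a ca]; exists a => s /H'H; apply: ca. Qed.

                                                                                
(** The maps [act s] are assumed to form an action for s in [X] only, since A^- carries an action of
    the decomposition group, not of the whole Galois group. *)
Variable X : set absGal.
Hypotheses (XM : forall s t, X s -> X t -> X (s * t)%g) (XV : forall s, X s -> X s^-1%g).
Hypotheses (actB : forall s, X s -> zmod_morphism (act s))
  (actM : forall s t a, X s -> X t -> act (s * t)%g a = act s (act t a)).

Let act0 s : X s -> act s 0 = 0.
Proof. by move=> Xs; have := actB Xs 0 0; rewrite !subr0 subrr. Qed.
Let actN s a : X s -> act s (- a) = - act s a.
Proof. by move=> Xs; rewrite -sub0r actB ?act0 ?sub0r. Qed.
Let actD s a b : X s -> act s (a + b) = act s a + act s b.
Proof. by move=> Xs; have := actB Xs a (- b); rewrite actN ?opprK. Qed.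
Let act_sum s (I : Type) (r : seq I) (F : I -> M) : X s ->
  act s (\sum_(i <- r) F i) = \sum_(i <- r) act s (F i).
Proof. by move=> Xs; apply: (big_morph (act s)) => [a b|]; [apply: actD|apply: act0]. Qed.
Let act_muln s a n : X s -> act s (a *+ n) = act s a *+ n.
Proof.
by move=> Xs; elim: n => [|n IHn]; rewrite ?mulr0n ?act0 // !mulrS actD ?IHn.
Qed.

Lemma cocycle_subr_coboundary (H : set absGal) c a : H `<=` X ->
  is_cocycle H c -> is_cocycle H (fun s => c s - (act s a - a)).
Proof.
move=> HX cH s t Hs Ht; rewrite cH // actM ?actB; try exact: HX.

rewrite addrACA -opprD; congr (_ - _).
by rewrite [in RHS]addrC addrA subrK.
Qed.

(** Expand c on t s = s (s^-1 t s) in both ways. *)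
Lemma cocycle_trivial_on_normal (H N : set absGal) c :
    H `<=` X -> N `<=` H -> is_cocycle H c ->
    (forall s t, H s -> N t -> N (s^-1 * t * s)%g) -> (forall t, N t -> c t = 0) ->
  forall s t, H s -> N t -> act t (c s) = c s.
Proof.
move=> HX NH cH Nn cN s t Hs Nt.
have -> : act t (c s) = c (t * s)%g by rewrite cH ?(cN _ Nt) ?add0r //; apply: NH.
have -> : (t * s = s * (s^-1 * t * s))%g by rewrite !mulgA mulgV mul1g.
have Nst := Nn _ _ Hs Nt.
by rewrite cH ?(cN _ Nst) ?act0 ?addr0 //; [apply: HX|apply: NH].
Qed.

(** Subtract from c the coboundary that it equals on I and Hm. For s in I and h in hs, the
    commutator of h and s lies in I and Hm, so (h - 1) c'(s) = (s - 1) c'(h). Summing over hs, whose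
    norm is 0, and dividing by -|hs| makes c' the coboundary of an explicit element. *)
Lemma coboundary_of_trivial_norm (Hn Hm I : set absGal) (hs : seq absGal) c :
    (forall s t, Hn s -> Hn t -> Hn (s * t)%g) -> (forall s t, Hm t -> Hm (s^-1 * t * s)%g) ->
    Hm `<=` Hn -> (forall s t, Hm (s * t * s^-1 * t^-1)%g) ->
    I `<=` X -> (forall s t, I s -> I t -> I (s * t)%g) -> (forall s, I s -> I s^-1%g) ->
    (forall s t, X s -> I t -> I (s * t * s^-1)%g) ->
    (forall h, h \in hs -> X h /\ Hm h) ->
    (forall a, \sum_(h <- hs) act h a = 0) ->
    (forall a : M, exists b, b *+ size hs = a) ->
    (forall a : M, a *+ size hs = 0 -> a = 0) ->
    is_cocycle (X `&` Hn) c -> coboundary act (I `&` Hm) c ->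
  coboundary act (I `&` Hn) c.
Proof.
move=> HnM HmN HmHn HmC IX IM IV IN hsP hs0 hs_div hs_tf cX [a ca].
pose c' s := c s - (act s a - a).
have c'X : is_cocycle (X `&` Hn) c' by apply: cocycle_subr_coboundary => // s [].
have c'0 s : I s -> Hm s -> c' s = 0 by move=> Is Hs; rewrite /c' ca // subrr.
have c'fix s t : X s -> Hn s -> I t -> Hm t -> act t (c' s) = c' s.
  move=> Xs Hs It Ht.
  apply: (@cocycle_trivial_on_normal (X `&` Hn) (I `&` Hm)) => //.
  - by move=> u [/IX Xu /HmHn Hu].
  - move=> u v [Xu Hu] [Iv Hv]; split; last exact: HmN.
    by have := IN u^-1%g v (XV Xu) Iv; rewrite invgK.
  - by move=> u [Iu Hu]; apply: c'0.
have swap s h : I s -> Hn s -> X h -> Hm h ->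
    act h (c' s) - c' s = act s (c' h) - c' h.
  move=> Is Hs Xh Hh; have Xs := IX _ Is; have Hh' := HmHn _ Hh.
  have Ik : I (h * s * h^-1 * s^-1)%g by apply: IM; [apply: IN|apply: IV].
  have Hk := HmC h s; set k := (h * s * h^-1 * s^-1)%g in Ik Hk.
  have Xk := IX _ Ik; have Hk' := HmHn _ Hk.
  have khs : (h * s = k * s * h)%g by rewrite /k mulgVK mulgVK.
  have XHks : (X `&` Hn) (k * s)%g by split; [apply: XM|apply: HnM].
  have Isks : I (s^-1 * k * s)%g by apply: (IM); [apply: (IM) => //; apply: IV|].
  have e : c' h + act h (c' s) = c' s + act s (c' h).
    rewrite -c'X // khs c'X // c'X // c'0 // add0r c'fix //; congr (_ + _).
    have -> : (k * s = s * (s^-1 * k * s))%g by rewrite !mulgA mulgV mul1g.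
    rewrite actM //; last exact: IX.
    by rewrite c'fix //; apply: HmN.
  have -> : act h (c' s) = c' s + act s (c' h) - c' h by rewrite -e addrAC subrr add0r.
  by rewrite [c' s + _]addrC addrAC addrK.
(* The sign comes from the sum of (h - 1) c'(s), which is -|hs| c'(s). *)
have [b bE] := hs_div (- \sum_(h <- hs) c' h).
exists (a + b) => s [Is Hs]; have Xs := IX _ Is.
suff : c' s = act s b - b.
  rewrite /c' => /eqP; rewrite subr_eq => /eqP ->.
  by rewrite actD // opprD [RHS]addrACA [LHS]addrC.
apply/eqP; rewrite -subr_eq0; apply/eqP; apply: hs_tf.
have e : \sum_(h <- hs) (act h (c' s) - c' s) = \sum_(h <- hs) (act s (c' h) - c' h).
  apply: eq_big_seq => h /hsP[Xh Hh]; exact: swap.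
move: e; rewrite [X in X = _]sumrB [X in _ = X]sumrB hs0 sub0r -act_sum //.
rewrite -[\sum_(h <- hs) c' h]opprK -bE actN ?act_muln //.
rewrite big_const_seq count_predT iter_addr_0 -opprD => /oppr_inj e.
by rewrite mulrnBl e mulrnBl subrr.
Qed.

(** Once corrected to vanish on the normal subgroup Hm, the cocycle takes values in the
    Hm-invariants, which are 0. *)
Lemma coboundary_of_restriction (Hn Hm : set absGal) c :
    Hn `<=` X -> Hm `<=` Hn -> (forall s t, Hn s -> Hm t -> Hm (s^-1 * t * s)%g) ->
    (forall a, (forall t, Hm t -> act t a = a) -> a = 0) ->
    is_cocycle Hn c -> coboundary act Hm c ->
  coboundary act Hn c.
Proof.
move=> HX HmHn HmN inv0 cH [a ca]; exists a => s Hs.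
apply/eqP; rewrite -subr_eq0; apply/eqP/inv0 => t Ht.
apply: (@cocycle_trivial_on_normal Hn Hm (fun s => c s - (act s a - a))) => //.
  exact: cocycle_subr_coboundary.
by move=> u Hu; rewrite ca // subrr.
Qed.

End Cocycles.

(** * Extension of invariant cocycles *)

Section CocycleExtension.

Variables (M : zmodType) (act : absGal -> M -> M) (H : nat -> set absGal).
Hypotheses (actB : forall s, zmod_morphism (act s))
  (actM : forall s t a, act (s * t)%g a = act s (act t a)).
Hypotheses (HM : forall n s t, H n s -> H n t -> H n (s * t)%g)
  (H_conj : forall n s t, H n t -> H n (s^-1 * t * s)%g)
  (H_decr : forall n m, (n <= m)%N -> H m `<=` H n)
  (H_inv0 : forall n a, (forall t, H n t -> act t a = a) -> a = 0).
Variables (n m : nat) (nm : (n <= m)%N) (c : absGal -> M).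
Hypothesis cH : is_cocycle act (H m) c.

Let act0 s : act s 0 = 0. Proof. by have := actB s 0 0; rewrite !subr0 subrr. Qed.
Let actN s a : act s (- a) = - act s a. Proof. by rewrite -sub0r actB act0 sub0r. Qed.
Let actD s a b : act s (a + b) = act s a + act s b.
Proof. by have := actB s a (- b); rewrite actN !opprK. Qed.

                                                                         
(** The coboundary of a measures how conjugation by g moves c, over some deeper H_k. Without
    invariants a is unique, and it is c g when g is in H_m: it is the value at g of the only
    possible extension of c. *)
Definition conj_defect (g : absGal) (a : M) := exists2 k, (m <= k)%N &
  forall h, H k h -> act g (c (g^-1 * h * g)%g) - c h = act h a - a.

Lemma conj_defect_uniq g a b : conj_defect g a -> conj_defect g b -> a = b.
Proof.
move=> [k mk ga] [l ml gb]; apply/eqP; rewrite -subr_eq0; apply/eqP.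
apply: (@H_inv0 (maxn k l)) => h Hh.
have {}ga := ga h (H_decr (leq_maxl k l) Hh); have {}gb := gb h (H_decr (leq_maxr k l) Hh).
have : act h a - a = act h b - b by rewrite -ga -gb.
move/eqP; rewrite subr_eq => /eqP e; by rewrite actB e addrC addrA addKr addrC.
Qed.

Lemma conj_defect_self g : H m g -> conj_defect g (c g).
Proof.
move=> Hg; exists m => // h Hh.
have Hgh : H m (g^-1 * h * g)%g by apply: H_conj.
have : c (g * (g^-1 * h * g))%g = c (h * g)%g by rewrite !mulgA mulgV mul1g.
rewrite (cH Hg Hgh) (cH Hh Hg) => e.
have -> : act g (c (g^-1 * h * g)%g) = c h + act h (c g) - c g.
  by rewrite -e addrAC subrr add0r.
by rewrite [LHS]addrC !addrA addNr add0r.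
Qed.

Lemma conj_defectM g g' a a' :
  conj_defect g a -> conj_defect g' a' -> conj_defect (g * g')%g (a + act g a').
Proof.
move=> [k mk ga] [l ml ga']; exists (maxn k l) => [|h Hh]; first by rewrite leq_max mk.
have {}ga := ga h (H_decr (leq_maxl k l) Hh).
have {}ga' := ga' (g^-1 * h * g)%g (H_decr (leq_maxr k l) (H_conj _ Hh)).
have -> : ((g * g')^-1 * h * (g * g') = g'^-1 * (g^-1 * h * g) * g')%g.
  by rewrite invMg !mulgA.
have ghE : (g * (g^-1 * h * g) = h * g)%g by rewrite !mulgA mulgV mul1g.
move/eqP: ga'; rewrite subr_eq => /eqP ga'.
move/eqP: ga; rewrite subr_eq => /eqP ga.
rewrite actM ga' actD actB -actM ghE ga actM actD opprD.
by rewrite addrA addrK [RHS]addrACA [RHS]addrC.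
Qed.

(** Defects multiply like a cocycle ([conj_defectM]), so uniqueness turns any choice of defects into
    a cocycle that extends c. *)
Lemma cocycle_extension :
    (forall g, H n g -> exists a, conj_defect g a) ->
  exists c', is_cocycle act (H n) c' /\ forall g, H m g -> c' g = c g.
Proof.
move=> ex_a; have /choice[c' c'P] g : exists a, H n g -> conj_defect g a.
  by have [/ex_a[a ga]|nHg] := pselect (H n g); [exists a|exists 0].
exists c'; split=> [s t Hs Ht|g Hg]; last first.
  by apply: (@conj_defect_uniq g); [apply/c'P/(H_decr nm)|apply: conj_defect_self].
apply: (@conj_defect_uniq (s * t)%g); first by apply/c'P/HM.
by apply: conj_defectM; apply: c'P.
Qed.

End CocycleExtension.

Lemma proj_eq0 (U : zmodType) (I : zmodClosed U) (x : U) : proj I x = 0 <-> x \in I.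
Proof.
have -> : 0 = proj I 0 by rewrite -(subrr 0) projB subrr.
by rewrite proj_eq subr0.
Qed.

Lemma projD (U : zmodType) (I : zmodClosed U) (x y : U) :
  proj I (x + y) = proj I x + proj I y.
Proof.
have p0 : proj I 0 = 0 by apply/proj_eq0; apply: rpred0.
by rewrite -[y]opprK projB -(sub0r (- y)) projB p0 sub0r.
Qed.

Lemma proj_sum (U : zmodType) (I : zmodClosed U) (J : Type) (r : seq J) (Q : pred J)
    (f : J -> U) :
  proj I (\sum_(i <- r | Q i) f i) = \sum_(i <- r | Q i) proj I (f i).
Proof.
have p0 : proj I 0 = 0 by apply/proj_eq0; apply: rpred0.
by apply: (big_morph (proj I) _ p0); apply: projD.
Qed.

(** * The modules A(phi) and A^-, and control of the Selmer groups *)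

Section SelmerModules.

Local Notation repr := generic_quotient.repr.

Variables (p : nat) (p_pr : prime p) (p_odd : odd p).
Variables (K : splittingFieldType rat) (kC : {rmorphism K -> algC}).
Hypothesis p_Delta : ~~ (p %| #|Delta_of K|)%N.
Variables (F : fieldExtType (Qp p_pr)) (d : nat) (rho : mx_representation F (Delta_of K) d).
Variables (P0 : set algC) (P0_prime : int_prime P0).
Variables (Vp : 'M[F]_d) (modVp : mxmodule (restr_decomp kC rho P0) Vp).
Hypothesis H0_V : rfix_mx rho (decomp_in kC P0) = 0.
Variables (T : stable_lattice rho) (phi : gamma_char F).

Local Notation Delta := (Delta_of K).
Local Notation O := (integers_of F).
Local Notation A := (A_mod T).
Local Notation act := (A_act kC phi (T := T)).
Local Notation H := (fun n => Gal_over (Q_ p n)).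
Local Notation Aplus := (A_plus (T := T) Vp).
Local Notation act' := (A_minus_act kC phi (T := T) (Vp := Vp)).

Lemma char1 : phi 1%g = 1.
Proof.
have [_ [y _ y1]] := char_unit phi 1%g.
have phi0 : phi 1%g != 0 by apply: contra_eq_neq y1 => ->; rewrite mul0r eq_sym oner_eq0.
by apply: (mulfI phi0); rewrite -Defs.charM mulg1 mulr1.
Qed.

(** By continuity at 1, phi h - 1 is divisible in O by every p^k. *)
Lemma char_infty h : Gal_over (Q_infty p) h -> phi h = 1.
Proof.
move=> hQ; apply/eqP; rewrite -subr_eq0; apply/eqP.
apply: (@val_ring_separated p p_pr F (GRing.in_alg F)) => k.
have [r rQ rP] := char_continuous phi 1%g k.
by have := rP h; rewrite char1; apply=> x /rQ Qx; rewrite hQ.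
Qed.

(** The limit t agrees on any finite list with a power of s, so it preserves [P0]; on K the exponent
    is 1 modulo |Delta|. *)
Lemma lift_decomposition g : g \in decomp_in kC P0 ->
  exists h, [/\ Gal_over (Q_infty p) h, decomposition P0 h & restriction kC h = g].
Proof.
move=> gD; have [s sD sg] := decomposition_lift P0_prime gD.
have gDelta : g \in Delta by apply: (fintype.subsetP (decomp_in_sub kC P0)).
have [t [_ tQ tP]] := prime_to_p_part p_pr s p_Delta; exists t; split=> //.
  apply: decomposition_sub => x Px; have [q [_ tx]] := tP [:: x].
  rewrite tx ?mem_head //; elim: (p ^ q)%N => [|k IHk]; first by rewrite expg0.
  by rewrite expgS absGalM; apply/decompositionP.
apply: restriction_eq => x; have [q [q1 tx]] := tP [:: kC x].
rewrite tx ?mem_head // -restrictionP restrictionX sg.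
by rewrite -(expg_mod _ (expg_cardG gDelta)) q1 expg_mod ?expg_cardG // expg1.
Qed.

Lemma decomp_card : ~~ (p %| #|decomp_in kC P0|)%N.
Proof.
apply: contra p_Delta => /dvdn_trans; apply.
exact: (@cardSg _ Delta (decomp_in_group kC P0) (decomp_in_sub kC P0)).
Qed.

Lemma norm_decomp (v : 'rV[F]_d) : \sum_(g in decomp_in kC P0) v *m rho g = 0.
Proof.
apply/eqP; rewrite -submx0 -H0_V; apply/rfix_mxP => h hD.
have DD := fintype.subsetP (decomp_in_sub kC P0).
rewrite mulmx_suml [RHS](reindex_inj (mulIg h)) /=; apply: eq_big => g.
  by rewrite (@groupMr _ (decomp_in_group kC P0)).
by move=> gD; rewrite -mulmxA -repr_mxM ?DD.
Qed.

Lemma A_act1 a : act 1%g a = a.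
Proof.
by rewrite -[a]reprK -/(proj T _) A_act_proj /V_act restriction1 char1 scale1r repr_mx1 mulmx1.
Qed.

Lemma A_act0 s : act s 0 = 0.
Proof.
have e : act s (0 - 0) = act s 0 - act s 0 by apply: A_actB.
by move: e; rewrite !subr0 subrr.
Qed.

Lemma A_act_proj_infty h v : Gal_over (Q_infty p) h ->
  act h (proj T v) = proj T (v *m rho (restriction kC h)).
Proof. by move=> hQ; rewrite A_act_proj /V_act char_infty // scale1r. Qed.

Lemma lattice_divn n v : ~~ (p %| n)%N -> v *+ n \in lattice T -> v \in lattice T.
Proof.
move=> /(val_ring_coprime_inv (GRing.in_alg F))[u Ou un] vT.
by rewrite -[v]scale1r -un -scalerA scaler_nat; apply: lattice_scale.
Qed.

(** For v representing a, each v g - v with g in the decomposition group lies in T. Their sum is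
    -|D| v because the norm of v is 0, and |D| is prime to p. *)
Lemma A_inv0 n (a : A) : (forall s, H n s -> act s a = a) -> a = 0.
Proof.
rewrite -[a]reprK -/(proj T _); set v := generic_quotient.repr a => fix_a.
have vD g : g \in decomp_in kC P0 -> v *m rho g - v \in lattice T.
  move=> gD; have [h [hQ _ hg]] := lift_decomposition gD.
  by apply/proj_eq; rewrite -(fix_a h) ?A_act_proj_infty ?hg //; apply: Gal_infty_sub.
have : \sum_(g in decomp_in kC P0) (v *m rho g - v) \in lattice T by apply: rpred_sum.
rewrite sumrB norm_decomp sub0r rpredN sumr_const => /(lattice_divn decomp_card) vT.
exact/proj_eq0.
Qed.

Lemma decomp_restriction s : decomposition P0 s -> restriction kC s \in decomp_in kC P0.
Proof.
move=> sD; rewrite inE mem_restriction; apply/asboolP => x.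
by rewrite /prime_in /= restrictionP; apply: decompositionP.
Qed.

Lemma A_act_plus s a : decomposition P0 s -> a \in Aplus -> act s a \in Aplus.
Proof.
move=> sD /asboolP[v vV ->]; apply/asboolP; rewrite A_act_proj.
exists (V_act kC rho phi s v) => //; apply: scalemx_sub.
have /mxmoduleP/(_ _ (decomp_restriction sD)) := modVp.
by apply: submx_trans; apply: submxMr.
Qed.

Lemma A_minus_act_proj s a :
  decomposition P0 s -> act' s (proj Aplus a) = proj Aplus (act s a).
Proof.
by move=> sD; apply: quot_map_proj => [|b]; [apply: A_actB|apply: A_act_plus].
Qed.

Lemma A_minus_proj (x : A_minus T Vp) : exists v, x = proj Aplus (proj T v).
Proof. by exists (repr (repr x)); rewrite /proj !reprK. Qed.

Lemma A_minus_actB s : decomposition P0 s -> zmod_morphism (act' s).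
Proof.
move=> sD; apply: quot_map_zmod_morphism => [|a]; first exact: A_actB.
exact: A_act_plus.
Qed.

Lemma A_minus_actM s t x : decomposition P0 s -> decomposition P0 t ->
  act' (s * t)%g x = act' s (act' t x).
Proof.
move=> sD tD; have [v ->] := A_minus_proj x.
by rewrite !A_minus_act_proj ?A_actM //; apply: decompositionM.
Qed.

Lemma projMn (U : zmodType) (I : zmodClosed U) (x : U) n : proj I (x *+ n) = proj I x *+ n.
Proof. exact: raddfMn. Qed.

Lemma A_minus_torsion_free n (x : A_minus T Vp) : ~~ (p %| n)%N -> x *+ n = 0 -> x = 0.
Proof.
move=> pn; have [v ->] := A_minus_proj x; rewrite -!projMn.
have [u Ou un] := val_ring_coprime_inv (GRing.in_alg F) pn.
move=> /proj_eq0/asboolP[w wV /proj_eq vw]; apply/proj_eq0/asboolP.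
exists (u *: w); first exact: scalemx_sub.
apply/proj_eq; have -> : v - u *: w = u *: (v *+ n - w).
  by rewrite scalerBr -scaler_nat scalerA un scale1r.
exact: lattice_scale.
Qed.

Lemma A_minus_divisible n (x : A_minus T Vp) : ~~ (p %| n)%N -> exists y, y *+ n = x.
Proof.
move=> pn; have [v ->] := A_minus_proj x.
have [u Ou un] := val_ring_coprime_inv (GRing.in_alg F) pn.
exists (proj Aplus (proj T (u *: v))); rewrite -!projMn.
by rewrite -scaler_nat scalerA mulrC un scale1r.
Qed.

Lemma A_minus_act_norm (hs : seq absGal) x :
    (forall h, h \in hs -> decomposition P0 h /\ Gal_over (Q_infty p) h) ->
    perm_eq (map (restriction kC) hs) (enum (decomp_in kC P0)) ->
  \sum_(h <- hs) act' h x = 0.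
Proof.
move=> hsP hsD; have [v ->] := A_minus_proj x.
rewrite (eq_big_seq (fun h => proj Aplus (proj T (v *m rho (restriction kC h))))); last first.
  by move=> h /hsP[hD hQ]; rewrite A_minus_act_proj // A_act_proj_infty.
rewrite -(big_map (restriction kC) xpredT (fun g => proj Aplus (proj T (v *m rho g)))).
rewrite (perm_big _ hsD) big_enum /=.
transitivity (proj Aplus (\sum_(g in decomp_in kC P0) proj T (v *m rho g))).
  by apply: esym; apply: proj_sum.
rewrite (_ : \sum_(g in _) _ = 0); first by apply/proj_eq0; apply: rpred0.
transitivity (proj T (\sum_(g in decomp_in kC P0) v *m rho g)).
  by apply: esym; apply: proj_sum.
by rewrite norm_decomp; apply/proj_eq0; apply: rpred0.
Qed.

(** Apply [coboundary_of_trivial_norm] inside the decomposition group of [P0], with hs a system of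
    lifts of D trivial on Q_infty: their norm kills A^-, on which |D| is invertible. *)
Lemma local_coboundary n m c : (n <= m)%N ->
    is_cocycle act (H n) c ->
    coboundary act' (Defs.inertia P0 `&` H m) (fun s => proj Aplus (c s)) ->
  coboundary act' (Defs.inertia P0 `&` H n) (fun s => proj Aplus (c s)).
Proof.
move=> nm cH.
have /choice[h hP] g : exists h, g \in decomp_in kC P0 ->
    [/\ Gal_over (Q_infty p) h, decomposition P0 h & restriction kC h = g].
  have [/lift_decomposition[h hP]|gD] := boolP (g \in decomp_in kC P0).
    by exists h.
  by exists 1%g.
pose hs := map h (enum (decomp_in kC P0)).
have hsP u : u \in hs -> decomposition P0 u /\ Gal_over (Q_infty p) u.
  by move=> /mapP[g]; rewrite mem_enum => /hP[hQ hD _] ->.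
have size_hs : size hs = #|decomp_in kC P0| by rewrite size_map -cardE.
have hs_perm : perm_eq (map (restriction kC) hs) (enum (decomp_in kC P0)).
  rewrite -map_comp (_ : map _ _ = enum (decomp_in kC P0)) //.
  rewrite -[RHS]map_id; apply/eq_in_map => g; rewrite mem_enum => /hP[_ _].
  exact.
have IX : Defs.inertia P0 `<=` decomposition P0 by move=> s [].
apply: (@coboundary_of_trivial_norm _ act' (decomposition P0) _ _ _ _ (H n) (H m) _ hs) => //.
- by move=> s t; apply: decompositionM.
- by move=> s; apply: decompositionV.
- exact: A_minus_actB.
- by move=> s t x; apply: A_minus_actM.
- by move=> s t; apply: Gal_overM.
- by move=> s t; apply: Gal_Q_conj.
- exact: Gal_Q_decr.
- by move=> s t; apply: Gal_infty_sub; apply: Gal_mu_sub_infty; apply: commutator_mu.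
- by move=> s t; apply: inertiaM.
- by move=> s; apply: inertiaV.
- by move=> s t; apply: inertia_conj.
- by move=> u /hsP[uD uQ]; split=> //; apply: Gal_infty_sub.
- by move=> x; apply: A_minus_act_norm.
- by move=> x; rewrite size_hs; apply: A_minus_divisible; apply: decomp_card.
- by move=> x; rewrite size_hs; apply: A_minus_torsion_free; apply: decomp_card.
move=> s t [sD sH] [tD tH]; rewrite cH // A_minus_act_proj //.
exact: projD.
Qed.

Variables (S : seq nat) (S_prime : all prime S) (p_S : p \in S).
Local Notation selmer_condition n := (Defs.selmer_condition kC phi (T := T) Vp S P0 n).
Local Notation cocycle n := (Defs.cocycle act (Q_Sigma S) (H n)).
Local Notation Sel_at n := (Defs.Sel_at kC T phi Vp S P0 n).

Lemma selmer_conditionB n (b c : absGal -> A) :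
  selmer_condition n b -> selmer_condition n c -> selmer_condition n (b - c).
Proof.
move=> [bl bp] [cl cp]; split=> [l P lS lp Pl|].
  have [_ cB] := coboundary_zmod_closed kC T phi (Defs.inertia P `&` H n).
  exact: cB (bl l P lS lp Pl) (cl l P lS lp Pl).
have [[x bx] [y cy]] := (bp, cp); exists (x - y) => s Is.
have -> : proj Aplus ((b - c) s) = proj Aplus (b s) - proj Aplus (c s) by apply: projB.
rewrite bx // cy // A_minus_actB; last by case: Is => -[].
by rewrite opprD addrACA -opprD.
Qed.

Lemma selmer_condition_B1 n (c : absGal -> A) : c \in B1_at kC phi n -> selmer_condition n c.
Proof.
move=> /asboolP[a ca]; split=> [l P _ _ _|]; first by exists a => s [_ /ca].
exists (proj Aplus a) => s [[sD _] /ca ->].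
by rewrite A_minus_act_proj //; apply: projB.
Qed.

(** The cocycle condition and the Selmer condition are imposed on possibly different
    representatives; coboundaries satisfy the latter, so one representative serves for both. *)
Lemma Sel_rep n x : Sel_at n x <->
  exists c, [/\ x = proj (B1_at kC phi n) c, cocycle n c & selmer_condition n c].
Proof.
split=> [[[c cc cx] [b bs bx]]|[c [-> cc cs]]]; last by split; exists c.
exists c; split=> //; have : b - c \in B1_at kC phi n by apply/proj_eq; rewrite bx cx.
move=> /selmer_condition_B1 /(selmer_conditionB bs).
by rewrite opprB addrCA subrr addr0.
Qed.

Lemma cocycleB n (b c : absGal -> A) : cocycle n b -> cocycle n c -> cocycle n (b - c).
Proof.
move=> [bM bK] [cM cK]; split=> [s t Hs Ht|s Hs].
  have -> : (b - c) (s * t)%g = b (s * t)%g - c (s * t)%g by [].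
  by rewrite bM // cM // opprD addrACA -A_actB.
have [r rL rb] := bK s Hs; have [q qL qc] := cK s Hs; exists (r ++ q) => [x|t Ht st].
  by rewrite mem_cat => /orP[/rL|/qL].
have -> : (b - c) t = b t - c t by [].
by rewrite rb ?qc // => x xr; apply: st; rewrite mem_cat xr ?orbT.
Qed.

Lemma Sel_atB n x y : Sel_at n x -> Sel_at n y -> Sel_at n (x - y).
Proof.
move=> /Sel_rep[b [-> bc bs]] /Sel_rep[c [-> cc cs]]; apply/Sel_rep; exists (b - c).
by split; [rewrite projB|apply: cocycleB|apply: selmer_conditionB].
Qed.

Lemma cocycle_restrict n m (c : absGal -> A) : (n <= m)%N -> cocycle n c -> cocycle m c.
Proof.
move=> nm [cM cK]; have HH := @Gal_Q_decr p n m nm; split=> [s t /HH Hs /HH Ht|s /HH Hs].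
  exact: cM.
by have [r rL rc] := cK s Hs; exists r => // t /HH; apply: rc.
Qed.

Lemma selmer_condition_restrict n m (c : absGal -> A) :
  (n <= m)%N -> selmer_condition n c -> selmer_condition m c.
Proof.
move=> nm [cl cp]; have HH := @Gal_Q_decr p n m nm.
split=> [l P lS lp Pl|].
  by apply: coboundary_sub (cl l P lS lp Pl) => s [Is /HH].
by apply: coboundary_sub cp => s [Is /HH].
Qed.

Lemma conj_cochain_B1 g (b : absGal -> A) :
  b \in B1_infty kC phi -> conj_cochain act g b \in B1_infty kC phi.
Proof.
move=> /asboolP[n /asboolP[a ba]]; apply/asboolP; exists n; apply/asboolP.
exists (act g a) => s Hs; rewrite /conj_cochain ba; last exact: Gal_Q_conj.
by rewrite A_actB -!A_actM !mulgA mulgV mul1g.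
Qed.

Lemma gamma_act_proj g (c : absGal -> A) :
  gamma_act g (proj (B1_infty kC phi) c) = proj (B1_infty kC phi) (conj_cochain act g c).
Proof.
apply/proj_eq; have := conj_cochain_B1 g (repr_proj (B1_infty kC phi) c).
set b := repr _.
rewrite (_ : conj_cochain _ _ _ = conj_cochain act g b - conj_cochain act g c) //.
by apply/funext => s; apply: A_actB.
Qed.

(** Inner automorphisms act trivially on H^1: conjugation by g moves c by the coboundary of c g. *)
Lemma res_infty_Sel n x : Sel_at n x -> Sel_infty_inv kC T phi Vp S P0 n (res_infty n x).
Proof.
move=> Sx; split=> [|g /(Gamma_sub (p := p)) Hg]; first by exists n => //; exists x.
have /Sel_rep[c [-> [cM _] _]] := Sx; rewrite res_infty_proj gamma_act_proj.
apply/proj_eq/asboolP; exists n; apply/asboolP; exists (c g) => h Hh.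
have ghE : (g * (g^-1 * h * g) = h * g)%g by rewrite !mulgA mulgV mul1g.
have := cM _ _ Hh Hg; rewrite -ghE cM //; last exact: Gal_Q_conj.
have -> : (conj_cochain act g c - c) h = act g (c (g^-1 * h * g)%g) - c h by [].
move=> e; apply/eqP; rewrite subr_eq addrAC eq_sym subr_eq eq_sym; apply/eqP.
by rewrite [LHS]addrC [RHS]addrC.
Qed.

Lemma res_infty_inj n : set_inj (Sel_at n) (res_infty n).
Proof.
move=> x y /set_mem/Sel_rep[b [-> [bM bK] _]] /set_mem/Sel_rep[c [-> [cM cK] _]].
rewrite !res_infty_proj => /proj_eq/asboolP[m bc]; apply/proj_eq/asboolP.
have nM := leq_maxl n m; have {bc}/asboolP bc := B1_at_incr (leq_maxr n m) bc.
apply: (@coboundary_of_restriction _ act setT _ _ (H n) (H (maxn n m))) => //.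
- by move=> s _; apply: A_actB.
- by move=> s t a _ _; apply: A_actM.
- exact: Gal_Q_decr.
- by move=> s t _; apply: Gal_Q_conj.
- by move=> a; apply: A_inv0.
- by have [] := cocycleB (conj bM bK) (conj cM cK).
Qed.

Lemma res_infty_surj n y : Sel_infty_inv kC T phi Vp S P0 n y ->
  exists2 x, Sel_at n x & res_infty n x = y.
Proof.
move=> [[m0 _ [x0 /Sel_rep[c [-> cc cs]] <-]] y_inv].
rewrite res_infty_proj in y_inv *; pose m := maxn n m0; have nm : (n <= m)%N := leq_maxl _ _.
have {cc}[cM cK] : cocycle m c := cocycle_restrict (leq_maxr _ _) cc.
have {cs}[cl cp] : selmer_condition m c := selmer_condition_restrict (leq_maxr _ _) cs.
have H_le a b : (a <= b)%N -> H b `<=` H a by exact: Gal_Q_decr.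
have HM a s t : H a s -> H a t -> H a (s * t)%g by exact: Gal_overM.
have [c' [c'M c'c]] : exists c', is_cocycle act (H n) c' /\ forall g, H m g -> c' g = c g.
  apply: (cocycle_extension (H := H)) => //.
  - exact: A_actB.
  - exact: A_actM.
  - by move=> a s t; apply: Gal_Q_conj.
  - by move=> k a; apply: A_inv0.
  (* The defect of u comes from the invariance of y, that of v is c v, and the two combine by
     [conj_defectM]. *)
  move=> g /(Gal_Q_decompose p_pr p_odd m)[u [v [Gu Hv ->]]].
  have := y_inv u Gu; rewrite gamma_act_proj => /proj_eq/asboolP[k /asboolP[a ua]].
  exists (a + act u (c v)); apply: (conj_defectM (H := H)) => //.
  - exact: A_actB.
  - exact: A_actM.
  - by move=> b s t; apply: Gal_Q_conj.
  - exists (maxn m k) => [|h Hh]; first exact: leq_maxl.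
    by apply: ua; apply: H_le Hh; apply: leq_maxr.
  by apply: (conj_defect_self (H := H)) => //; move=> b s t; apply: Gal_Q_conj.
(* If t agrees with s on a primitive p^(m+1)-th root of unity, then s^-1 t lies in H_m. Agreement on
   r as well, where continuity of c at 1 is tested, gives c(s^-1 t) = c(1) = 0. *)
have c'K : krull_continuous (Q_Sigma S) (H n) c'.
  move=> s Hs; have [r rL rc] := cK 1%g (@Gal_over1 _).
  have pm0 : (0 < p ^ m.+1)%N by rewrite expn_gt0 prime_gt0.
  have [zeta zetaP] := C_prim_root_exists pm0.
  have zeta_mu : Q_Sigma S zeta.
    apply: (mu_sub_Q_Sigma p_pr p_S); apply: sub_gen_subfield.
    by exists m.+1; apply: prim_expr_order.
  exists (zeta :: r) => [x|t Ht st]; first by rewrite inE => /orP[/eqP -> //|/rL].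
  pose w : absGal := (s^-1 * t)%g.
  have wfix x : x \in zeta :: r -> w x = x by move=> /st xst; rewrite /w absGalM -xst absGalK.
  have Hw : H m w.
    apply: (fix_roots_Gal_Q p_pr p_odd) => _ /(prim_rootP zetaP)[i ->].
    by rewrite absGalX wfix ?mem_head.
  have c1 : c 1%g = 0.
    have := cM 1%g 1%g (@Gal_over1 _) (@Gal_over1 _); rewrite mulg1 A_act1 => /eqP.
    by rewrite -subr_eq subrr => /eqP.
  have -> : t = (s * w)%g by rewrite /w mulgA mulgV mul1g.
  rewrite c'M //; last exact: Gal_overM (Gal_overV Hs) Ht.
  rewrite (c'c w Hw) (rc w Hw) => [|x xr]; last by rewrite wfix // inE xr orbT.
  by rewrite c1 A_act0 addr0.
(* Away from p the inertia group already lies in H_m, where c' and c coincide. *)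
have inertia_H l P : l \in S -> l != p -> Defs.prime_above l P ->
    Defs.inertia P `<=` H m.
  move=> lS lp Pl s sI; apply: Gal_infty_sub; apply: Gal_mu_sub_infty.
  by apply: (inertia_mu p_pr Pl) => //; apply: (allP S_prime).
exists (proj (B1_at kC phi n) c'); last first.
  rewrite res_infty_proj; apply/proj_eq/asboolP; exists m; apply/asboolP; exists 0 => s Hs.
  have -> : (c' - c) s = c' s - c s by [].
  by rewrite c'c // subrr A_act0 subrr.
apply/Sel_rep; exists c'; split=> //; split=> [l P lS lp Pl|].
  have [a ca] := cl l P lS lp Pl; exists a => s [sI _].
  have Hs := inertia_H l P lS lp Pl s sI.
  by rewrite c'c // ca.
apply: (local_coboundary nm c'M); have [a ca] := cp; exists a => s [sI Hs].
by rewrite c'c // ca.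
Qed.

Lemma res_inftyB n x y :
  @res_infty _ _ _ kC _ _ _ T phi n (x - y) = res_infty n x - res_infty n y.
Proof.
rewrite -[x in LHS]reprK -[y in LHS]reprK -!/(proj _ _).
have -> : proj (B1_at kC phi n) (repr x) - proj (B1_at kC phi n) (repr y) =
    proj (B1_at kC phi n) (repr x - repr y) by apply: esym; apply: projB.
by rewrite res_infty_proj; apply: projB.
Qed.

End SelmerModules.

Theorem theorem4p1 (p : nat) (p_pr : prime p) (p_odd : odd p)
  (Qpbar : closedFieldType) (j : {rmorphism Qp p_pr -> Qpbar})
  (j_alg : forall x, algebraicOver j x)
  (iota : {rmorphism algC -> Qpbar})
  (K : splittingFieldType rat) (kC : {rmorphism K -> algC})
  (mu_p_K : exists z : K, p.-primitive_root z)
  (p_Delta : ~~ (p %| #|Delta_of K|)%N)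
  (F : fieldExtType (Qp p_pr)) (d : nat)
  (rho : mx_representation F (Delta_of K) d)
  (rho_irr : mx_irreducible rho)
  (P0 : set algC) (P0_def : P0 = prime_of_embedding j iota)
  (Vp : 'M[F]_d) (modVp : mxmodule (restr_decomp kC rho P0) Vp)
  (rank_Vp : \rank Vp = d_plus kC rho)
  (d_plus_bounds : (0 < d_plus kC rho < d)%N)
  (Vp_disjoint :
     no_common_component (submod_repr modVp) (factmod_repr modVp))
  (H0_V : rfix_mx rho (decomp_in kC P0) = 0)
  (T : stable_lattice rho)
  (S : seq nat) (S_prime : all prime S) (p_S : p \in S)
  (K_S : forall l, prime l -> ~ unramified_at l (range kC) -> l \in S)
  (phi : gamma_char F) :
  (forall n,
     set_fun (Sel_at kC T phi Vp S P0 n) (Sel_infty_inv kC T phi Vp S P0 n)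
       (res_infty n) /\
     set_inj (Sel_at kC T phi Vp S P0 n) (res_infty n)) /\
  exists N, forall n,
    let C := cokernel (res_infty n) (Sel_at kC T phi Vp S P0 n)
               (Sel_infty_inv kC T phi Vp S P0 n) in
    finite_set C /\ (C #<= `I_N)%card.
Proof.
have [P0_prime _] : Defs.prime_above p P0.
  by rewrite P0_def; apply: prime_of_embedding_above.
have res_surj n y := @res_infty_surj p p_pr p_odd K kC p_Delta F d rho P0 P0_prime Vp modVp
  H0_V T phi S S_prime p_S n y.
split=> [n|].
  split=> [x Sx|]; first exact: res_infty_Sel.
  exact: (res_infty_inj p_Delta P0_prime modVp H0_V).
(* By surjectivity every coset in the cokernel is the image of [Sel] itself. *)
exists 1%N => n C; set f := res_infty n in C *; set Sel := Sel_at kC T phi Vp S P0 n in C *.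
have SelB x y : Sel x -> Sel y -> Sel (x - y) by apply: Sel_atB.
have CE : C `<=` [set f @` Sel].
  move=> _ [_ /res_surj[x Sx <-] <-] /=; apply/seteqP; split=> [_ [y Sy <-]|_ [y Sy <-]].
    (* This is x + y, written with the subtractions under which [Sel] is known to be closed. *)
    exists (x - (x - x - y)); first by apply: (SelB) => //; apply: (SelB) => //; apply: SelB.
    by rewrite /f !res_inftyB subrr sub0r opprK.
  exists (y - x); first exact: SelB.
  by rewrite /f res_inftyB addrCA subrr addr0.
split; first by apply: sub_finite_set CE _; apply: finite_set1.
have := @card_set1 _ (f @` Sel); rewrite card_eq_le => /andP[+ _].
exact: card_le_trans (subset_card_le CE).
Qed.
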